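(* Let $p\in\mathcal{H}$ satisfy $p(0)=1$, let $\varphi_{Ne}(z):=1+z-z^3/3$, and let $$p(z)+\beta zp'(z)\prec\varphi_L(z)=\sqrt{1+z},\qquad \beta>0.$$ If $\beta\geq\beta_L$, then $p\prec\varphi_{Ne}$, where $\beta_L$ is the unique root in $(0,\infty)$ of the equation (in the unknown $\beta$) $$\frac{3}{\Gamma(-\frac12)}\sum_{j=0}^\infty\frac{\Gamma(-\frac12+j)}{j!\,(1+j\beta)}-1=0.$$ The estimate on $\beta$ is best possible.
   Context: $\mathbb{D}=\{z\in\mathbb{C}:|z|<1\}$ and $\mathcal{H}$ is the set of all analytic functions on $\mathbb{D}$. For $f,g\in\mathcal{H}$, $f\prec g$ ($f$ is subordinate to $g$) means that there is $w\in\mathcal{H}$ with $w(0)=0$ and $|w(z)|<1$ for $z\in\mathbb{D}$ such that $f(z)=g(w(z))$ on $\mathbb{D}$. The branch of the square root is chosen so that $\varphi_L(0)=1$. $\Gamma$ is the Gamma function (so $\Gamma(-\frac12+j)/\Gamma(-\frac12)$ is the Pochhammer symbol $(-\frac12)_j$). That the estimate $\beta\ge\beta_L$ is best possible means that $\beta_L$ cannot be replaced by any smaller positive number so that the implication remains valid for all such $p$ and all $\beta$ at least that number. *)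

(* Defs.v *)
From Stdlib Require Import Reals Arith Lra.
From Coquelicot Require Import Coquelicot.

Open Scope R_scope.

Definition in_disc (z : C) : Prop := Cmod z < 1.

(* The disc is open, so only the values of [f] near the disc's points matter:
   a function on the disc is represented by an arbitrary extension to [C]. *)
Definition analytic_on_disc (f : C -> C) : Prop :=
  forall z : C, in_disc z -> ex_derive f z.

Definition subordinate (f g : C -> C) : Prop :=
  exists w : C -> C,
    analytic_on_disc w /\
    w (RtoC 0) = RtoC 0 /\
    (forall z : C, in_disc z -> Cmod (w z) < 1) /\
    (forall z : C, in_disc z -> f z = g (w z)).

(* Principal branch. *)
Definition Csqrt (z : C) : C :=
  (sqrt ((Cmod z + Re z) / 2),
   if Rle_dec 0 (Im z) then sqrt ((Cmod z - Re z) / 2)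
   else - sqrt ((Cmod z - Re z) / 2)).

Definition phi_L (z : C) : C := Csqrt (RtoC 1 + z)%C.

Definition phi_Ne (z : C) : C := (RtoC 1 + z - z ^ 3 / RtoC 3)%C.

(* Gamma function on the reals that are not poles (0, -1, -2, ...), as
   the Euler-Gauss limit  n! n^x / (x (x + 1) ... (x + n)).  This is valid
   for negative [x] too, where Euler's integral diverges. *)
Definition Gamma (x : R) : R :=
  real (Lim_seq (fun n : nat =>
    INR (fact n) * Rpower (INR n) x / prod_f_R0 (fun k => x + INR k) n)).

Definition beta_term (beta : R) (j : nat) : R :=
  Gamma (- (1 / 2) + INR j) / (INR (fact j) * (1 + INR j * beta)).

(* Convergence is asked for because [Series] is a total operator. *)
Definition beta_equation (beta : R) : Prop :=
  ex_series (beta_term beta) /\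
  3 / Gamma (- (1 / 2)) * Series (beta_term beta) - 1 = 0.

Definition implication_at (beta : R) : Prop :=
  forall p : C -> C,
    analytic_on_disc p ->
    p (RtoC 0) = RtoC 1 ->
    subordinate (fun z => p z + RtoC beta * z * C_derive p z)%C phi_L ->
    subordinate p phi_Ne.

Lemma Re_le_Cmod (z : C) : - Cmod z <= Re z <= Cmod z.
Proof.
pose proof (Rmax_Cmod z) as H.
pose proof (Rmax_l (Rabs (fst z)) (Rabs (snd z))) as H1.
unfold Re; revert H1; unfold Rabs; destruct (Rcase_abs (fst z));
  intros; unfold Rabs in *; split; destruct (Rcase_abs (fst z)); lra.
Qed.

Lemma Cmod_sqr (z : C) : Cmod z * Cmod z = Re z * Re z + Im z * Im z.
Proof.
unfold Cmod, Re, Im; rewrite sqrt_sqrt; simpl; [ring | nra].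
Qed.

Lemma Csqrt_sqr (z : C) : (Csqrt z * Csqrt z)%C = z.
Proof.
pose proof (Re_le_Cmod z) as H; pose proof (Cmod_sqr z) as M.
assert (P : 0 <= (Cmod z + Re z) / 2) by lra.
assert (N : 0 <= (Cmod z - Re z) / 2) by lra.
pose proof (sqrt_sqrt _ P) as SP; pose proof (sqrt_sqrt _ N) as SN.
assert (SI : 2 * (sqrt ((Cmod z + Re z) / 2) * sqrt ((Cmod z - Re z) / 2))
             = Rabs (Im z)).
{ rewrite <- sqrt_mult by assumption.
  replace ((Cmod z + Re z) / 2 * ((Cmod z - Re z) / 2))
    with (Rsqr (Im z / 2))
    by (replace ((Cmod z + Re z) / 2 * ((Cmod z - Re z) / 2))
          with ((Cmod z * Cmod z - Re z * Re z) / 4) by field;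
        rewrite M; unfold Rsqr; field).
  rewrite sqrt_Rsqr_abs; unfold Rdiv; rewrite Rabs_mult.
  rewrite (Rabs_pos_eq (/ 2)) by lra; field. }
unfold Csqrt, Cmult; destruct (Rle_dec 0 (Im z)) as [h|h]; simpl;
  apply injective_projections; simpl; fold (Re z) (Im z); try nra.
- rewrite Rabs_pos_eq in SI by assumption; lra.
- rewrite Rabs_left in SI by lra; lra.
Qed.

(* The next three lemmas check that [phi_L] is, on the disc, the branch of
   the square root of 1 + z with value 1 at 0. *)
Lemma phi_L_sqr (z : C) : (phi_L z * phi_L z)%C = (RtoC 1 + z)%C.
Proof. apply Csqrt_sqr. Qed.

Lemma phi_L_Re_gt0 (z : C) : in_disc z -> 0 < Re (phi_L z).
Proof.
unfold in_disc; intros h; pose proof (Re_le_Cmod z) as H.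
pose proof (Cmod_ge_0 (RtoC 1 + z)) as G.
change (0 < sqrt ((Cmod (RtoC 1 + z) + (1 + Re z)) / 2)).
apply sqrt_lt_R0; lra.
Qed.

Lemma phi_L_0 : phi_L (RtoC 0) = RtoC 1.
Proof.
unfold phi_L; rewrite Cplus_0_r; unfold Csqrt; rewrite Cmod_1; simpl.
destruct (Rle_dec 0 0) as [_|h]; [|lra].
replace ((1 + 1) / 2) with 1 by field; replace ((1 - 1) / 2) with 0 by field.
rewrite sqrt_1, sqrt_0; reflexivity.
Qed.

(* Main.v *)
(* Write phi_L(-z) = A(z) = sum_j a_j z^j with a_j = (-1/2)_j / j!, so that a_0 = 1
   and a_j < 0 afterwards, and let B(z) = sum_j a_j z^j / (1 + j beta), which
   solves B + beta z B' = A.  The equation for beta_L says B(1) = 1/3, and B(1)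
   increases with beta.
   If p + beta z p' = phi_L(w), then |w(z)| <= |z| by the Schwarz lemma, hence
   |phi_L(w(z)) - 1| <= 1 - A(|z|) because all a_j but the first are negative.
   Comparing the differential equations of p and B along rays gives
   |p(z) - 1| <= 1 - B(|z|) < 1 - B(1) <= 2/3.  The disc |zeta - 1| < 2/3 lies
   inside the nephroid domain phi_Ne(D), and phi_Ne has an analytic inverse there.
   If beta < beta_L, the function q(z) = B(-z) takes real values below 1/3 near
   z = -1, while the real points of phi_Ne(D) are larger than 1/3.
   The Schwarz lemma is derived for functions that are merely complex
   differentiable, from Goursat's bisection argument in polar coordinates. *)

Require Import Defs.
From Stdlib Require Import Arith Reals Ranalysis5 Lra Lia Psatz.
From Coquelicot Require Import Coquelicot.

Open Scope R_scope.

(** * Complex derivatives *)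

(** The threshold is sharp because the two directions meet at one point: phi_Ne(-1) = 1/3 is at
    distance 2/3 from 1, the radius on which the inverse of phi_Ne is built, and the extremal
    function takes real values tending to B(1) at -1. Hence the condition B(1) >= 1/3 on both sides.

    The shaping obstacle is that analyticity means complex differentiability at each point and
    nothing more: neither expansions of p and w nor continuity of their derivatives are available at
    the start. So p and w are only ever estimated, and power series are used just for the explicit
    functions A and B.

    Moduli are turned into real quantities by one device, used both for the maximum modulus
    principle and for the differential equation: fix a point, multiply by the conjugate of the value
    there, and take real parts. The comparison of p with B then concerns a real function of one
    variable and is settled at its maximum, without solving the equation for p.

    All estimates on A and B rest on three facts about their coefficients: the leading one is 1, the
    others are nonpositive, and partial sums are nonnegative. *)

Definition little_o (e : C -> C) : Prop :=
  forall eps : R, 0 < eps ->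
  exists d : R, 0 < d /\
    forall h : C, Cmod h < d -> Cmod (e h) <= eps * Cmod h.

(** Epsilon-delta form of the complex derivative, phrased with [Cmod] so that error terms can be
    estimated directly; [is_derive_has_cderiv] and [has_cderiv_is_derive] tie it to the library
    notion. *)
Definition has_cderiv (f : C -> C) (z l : C) : Prop :=
  little_o (fun h => f (z + h) - f z - l * h)%C.

Lemma Cmod_minus_le (x y : C) : Cmod (x - y) <= Cmod x + Cmod y.
Proof.
unfold Cminus; rewrite <- (Cmod_opp y); apply Cmod_triangle.
Qed.

Lemma RtoC_neq (x y : R) : x <> y -> RtoC x <> RtoC y.
Proof. intros H E; apply H, RtoC_inj, E. Qed.

Lemma Cmod_rev_triangle (x y : C) : Cmod x - Cmod y <= Cmod (x + y).
Proof.
pose proof (Cmod_minus_le (x + y) y) as H.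
replace (x + y - y)%C with x in H by ring; lra.
Qed.

Lemma is_derive_has_cderiv (f : C -> C) (z l : C) :
  @is_derive C_AbsRing C_NormedModule f z l -> has_cderiv f z l.
Proof.
intros [_ H] eps Heps.
specialize (H z (fun P HP => HP) (mkposreal _ Heps)).
apply (@locally_le_locally_norm C_AbsRing (AbsRing_NormedModule C_AbsRing)) in H.
destruct H as [d Hd]; exists d; split; [apply cond_pos|].
intros h Hh.
assert (E : (z + h - z = h)%C) by ring.
specialize (Hd (z + h)%C).
assert (B : @ball_norm C_AbsRing (AbsRing_NormedModule C_AbsRing) z d (z + h)%C).
{ change (Cmod (z + h - z) < d); rewrite E; exact Hh. }
specialize (Hd B).
change (Cmod (f (z + h) - f z - (z + h - z) * l) <= eps * Cmod (z + h - z))%C in Hd.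
rewrite E, (Cmult_comm h l) in Hd; exact Hd.
Qed.

Lemma has_cderiv_is_derive (f : C -> C) (z l : C) :
  has_cderiv f z l -> @is_derive C_AbsRing C_NormedModule f z l.
Proof.
intros H; split; [apply is_linear_scal_l|].
intros x Hx.
assert (x = z).
{ symmetry; apply (@is_filter_lim_locally_unique C_AbsRing
    (AbsRing_NormedModule C_AbsRing) z x Hx). }
subst x; clear Hx; intros [eps Heps].
apply (@locally_norm_le_locally C_AbsRing (AbsRing_NormedModule C_AbsRing)).
destruct (H eps Heps) as [d [Hd Hl]].
exists (mkposreal d Hd); intros y Hy.
change (Cmod (y - z) < d)%C in Hy.
specialize (Hl _ Hy).
assert (E : (z + (y - z) = y)%C) by (destruct y, z; apply injective_projections; simpl; ring).
rewrite E, (Cmult_comm l) in Hl; exact Hl.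
Qed.

Lemma little_o_ext (e1 e2 : C -> C) :
  (forall h, e1 h = e2 h) -> little_o e1 -> little_o e2.
Proof.
intros E H eps Heps; destruct (H eps Heps) as [d [Hd Hl]].
exists d; split; [exact Hd|]; intros h Hh; rewrite <- E; auto.
Qed.

Lemma little_o_plus (e1 e2 : C -> C) :
  little_o e1 -> little_o e2 -> little_o (fun h => e1 h + e2 h)%C.
Proof.
intros H1 H2 eps Heps.
destruct (H1 (eps / 2)) as [d1 [P1 L1]]; [lra|].
destruct (H2 (eps / 2)) as [d2 [P2 L2]]; [lra|].
exists (Rmin d1 d2); split; [apply Rmin_glb_lt; assumption|].
intros h Hh.
pose proof (L1 h (Rlt_le_trans _ _ _ Hh (Rmin_l _ _))).
pose proof (L2 h (Rlt_le_trans _ _ _ Hh (Rmin_r _ _))).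
pose proof (Cmod_triangle (e1 h) (e2 h)); lra.
Qed.

Lemma little_o_scal (c : C) (e : C -> C) :
  little_o e -> little_o (fun h => c * e h)%C.
Proof.
intros H eps Heps.
pose proof (Cmod_ge_0 c) as Hc.
destruct (H (eps / (Cmod c + 1))) as [d [Hd Hl]].
{ apply Rdiv_lt_0_compat; lra. }
exists d; split; [exact Hd|]; intros h Hh; rewrite Cmod_mult.
specialize (Hl h Hh); pose proof (Cmod_ge_0 h); pose proof (Cmod_ge_0 (e h)).
apply Rle_trans with ((Cmod c + 1) * (eps / (Cmod c + 1) * Cmod h)).
- apply Rmult_le_compat; lra.
- right; field; lra.
Qed.

(** A quadratic error bound is how the derivatives of [Cinv], of power series and of the inverse
    nephroid map are all obtained. *)
Lemma little_o_square (e : C -> C) (K d : R) :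
  0 < d -> (forall h, Cmod h < d -> Cmod (e h) <= K * Cmod h ^ 2) ->
  little_o e.
Proof.
intros Hd H eps Heps.
assert (HK : 0 < Rabs K + 1) by (pose proof (Rabs_pos K); lra).
exists (Rmin d (eps / (Rabs K + 1))); split.
{ apply Rmin_glb_lt; [exact Hd|]; apply Rdiv_lt_0_compat; lra. }
intros h Hh.
pose proof (H h (Rlt_le_trans _ _ _ Hh (Rmin_l _ _))) as H1.
pose proof (Rlt_le_trans _ _ _ Hh (Rmin_r _ _)) as H2.
pose proof (Cmod_ge_0 h) as H3; pose proof (Rle_abs K).
apply Rlt_div_r in H2; [|lra]; nra.
Qed.

Lemma has_cderiv_square (f : C -> C) (z l : C) (K d : R) :
  0 < d ->
  (forall h, Cmod h < d ->
     Cmod (f (z + h) - f z - l * h)%C <= K * Cmod h ^ 2) ->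
  has_cderiv f z l.
Proof. intros Hd H; exact (little_o_square _ K d Hd H). Qed.

Lemma has_cderiv_lipschitz (f : C -> C) (z l : C) :
  has_cderiv f z l ->
  exists d, 0 < d /\
    forall h, Cmod h < d -> Cmod (f (z + h) - f z)%C <= (Cmod l + 1) * Cmod h.
Proof.
intros H; destruct (H 1 Rlt_0_1) as [d [Hd Hl]].
exists d; split; [exact Hd|]; intros h Hh; specialize (Hl h Hh).
replace (f (z + h) - f z)%C with ((f (z + h) - f z - l * h) + l * h)%C by ring.
eapply Rle_trans; [apply Cmod_triangle|]; rewrite (Cmod_mult l h); lra.
Qed.

Lemma has_cderiv_continuous (f : C -> C) (z l : C) :
  has_cderiv f z l ->
  forall eps, 0 < eps -> exists d, 0 < d /\
    forall h, Cmod h < d -> Cmod (f (z + h) - f z)%C < eps.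
Proof.
intros H eps Heps; destruct (has_cderiv_lipschitz _ _ _ H) as [d [Hd Hl]].
pose proof (Cmod_ge_0 l).
exists (Rmin d (eps / (Cmod l + 1))); split.
{ apply Rmin_glb_lt; [exact Hd|]; apply Rdiv_lt_0_compat; lra. }
intros h Hh.
pose proof (Hl h (Rlt_le_trans _ _ _ Hh (Rmin_l _ _))) as H1.
pose proof (Rlt_le_trans _ _ _ Hh (Rmin_r _ _)) as H2.
apply Rlt_div_r in H2; [|lra]; lra.
Qed.

Lemma has_cderiv_ext_near (f g : C -> C) (z l : C) (d : R) :
  0 < d -> (forall h, Cmod h < d -> f (z + h)%C = g (z + h)%C) ->
  has_cderiv f z l -> has_cderiv g z l.
Proof.
intros Hd E H eps Heps; destruct (H eps Heps) as [d' [Hd' Hl]].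
exists (Rmin d d'); split; [apply Rmin_glb_lt; assumption|].
intros h Hh.
assert (E0 : f z = g z).
{ replace z with (z + 0)%C by ring; apply E; rewrite Cmod_0; exact Hd. }
rewrite <- E0, <- E by (eapply Rlt_le_trans; [exact Hh|apply Rmin_l]).
apply Hl; eapply Rlt_le_trans; [exact Hh|apply Rmin_r].
Qed.

Lemma has_cderiv_ext (f g : C -> C) (z l : C) :
  (forall x, f x = g x) -> has_cderiv f z l -> has_cderiv g z l.
Proof.
intros E; apply has_cderiv_ext_near with 1; [lra|auto].
Qed.

Lemma has_cderiv_const (c z : C) : has_cderiv (fun _ => c) z 0.
Proof.
apply has_cderiv_square with 0 1; [lra|]; intros h _.
replace (c - c - 0 * h)%C with (RtoC 0) by ring; rewrite Cmod_0; lra.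
Qed.

Lemma has_cderiv_id (z : C) : has_cderiv (fun x => x) z 1.
Proof.
apply has_cderiv_square with 0 1; [lra|]; intros h _.
replace (z + h - z - 1 * h)%C with (RtoC 0) by ring; rewrite Cmod_0; lra.
Qed.

Lemma has_cderiv_plus (f g : C -> C) (z l m : C) :
  has_cderiv f z l -> has_cderiv g z m ->
  has_cderiv (fun x => f x + g x)%C z (l + m)%C.
Proof.
intros Hf Hg; eapply little_o_ext; [|exact (little_o_plus _ _ Hf Hg)].
intros h; simpl; ring.
Qed.

Lemma has_cderiv_mult (f g : C -> C) (z l m : C) :
  has_cderiv f z l -> has_cderiv g z m ->
  has_cderiv (fun x => f x * g x)%C z (l * g z + f z * m)%C.
Proof.
intros Hf Hg.
destruct (has_cderiv_lipschitz _ _ _ Hf) as [d1 [P1 L1]].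
destruct (has_cderiv_lipschitz _ _ _ Hg) as [d2 [P2 L2]].
(* The error of the product is this product of increments, of order |h|^2, plus the errors of f and
   g weighted by g z and f z. *)
assert (Q : little_o (fun h => (f (z + h) - f z) * (g (z + h) - g z))%C).
{ apply little_o_square with ((Cmod l + 1) * (Cmod m + 1)) (Rmin d1 d2);
    [apply Rmin_glb_lt; assumption|].
  intros h Hh; rewrite Cmod_mult.
  pose proof (L1 h (Rlt_le_trans _ _ _ Hh (Rmin_l _ _))).
  pose proof (L2 h (Rlt_le_trans _ _ _ Hh (Rmin_r _ _))).
  replace ((Cmod l + 1) * (Cmod m + 1) * Cmod h ^ 2)
    with (((Cmod l + 1) * Cmod h) * ((Cmod m + 1) * Cmod h)) by ring.
  apply Rmult_le_compat; auto using Cmod_ge_0. }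
eapply little_o_ext;
  [|exact (little_o_plus _ _ Q
       (little_o_plus _ _ (little_o_scal (g z) _ Hf) (little_o_scal (f z) _ Hg)))].
intros h; simpl; ring.
Qed.

Lemma has_cderiv_scal (c : C) (f : C -> C) (z l : C) :
  has_cderiv f z l -> has_cderiv (fun x => c * f x)%C z (c * l)%C.
Proof.
intros Hf; eapply little_o_ext; [|exact (little_o_scal c _ Hf)].
intros h; simpl; ring.
Qed.

Lemma has_cderiv_comp (f g : C -> C) (z l m : C) :
  has_cderiv f (g z) l -> has_cderiv g z m ->
  has_cderiv (fun x => f (g x)) z (l * m)%C.
Proof.
intros Hf Hg.
destruct (has_cderiv_lipschitz _ _ _ Hg) as [d1 [P1 L1]].
assert (Q : little_o
  (fun h => f (g z + (g (z + h) - g z)) - f (g z) - l * (g (z + h) - g z))%C).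
{ intros eps Heps; pose proof (Cmod_ge_0 m).
  destruct (Hf (eps / (Cmod m + 1))) as [d2 [P2 L2]].
  { apply Rdiv_lt_0_compat; lra. }
  destruct (has_cderiv_continuous _ _ _ Hg d2 P2) as [d3 [P3 L3]].
  exists (Rmin d1 d3); split; [apply Rmin_glb_lt; assumption|].
  intros h Hh.
  pose proof (L1 h (Rlt_le_trans _ _ _ Hh (Rmin_l _ _))) as H1.
  pose proof (L3 h (Rlt_le_trans _ _ _ Hh (Rmin_r _ _))) as H3.
  eapply Rle_trans; [apply L2; exact H3|].
  apply Rle_trans with (eps / (Cmod m + 1) * ((Cmod m + 1) * Cmod h)).
  - apply Rmult_le_compat_l; [|exact H1].
    apply Rlt_le, Rdiv_lt_0_compat; lra.
  - right; field; lra. }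
eapply little_o_ext; [|exact (little_o_plus _ _ Q (little_o_scal l _ Hg))].
intros h; simpl.
replace (g z + (g (z + h) - g z))%C with (g (z + h)%C) by ring; ring.
Qed.

Lemma has_cderiv_inv (z : C) :
  z <> 0 -> has_cderiv Cinv z (- / (z * z))%C.
Proof.
intros Hz; assert (Pz := proj1 (Cmod_gt_0 z) Hz).
apply has_cderiv_square with (2 / Cmod z ^ 3) (Cmod z / 2); [lra|].
intros h Hh.
pose proof (Cmod_rev_triangle z h) as Hr.
assert (Hzh : (z + h)%C <> 0) by (apply Cmod_gt_0; lra).
replace (/ (z + h) - / z - - / (z * z) * h)%C
  with (h * h / (z * z * (z + h)))%C
  by (field; repeat split; assumption).
rewrite Cmod_div by (repeat apply Cmult_neq_0; assumption).
rewrite !Cmod_mult.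
apply Rle_trans with (Cmod h * Cmod h / (Cmod z * Cmod z * (Cmod z / 2))).
- unfold Rdiv at 1 2; apply Rmult_le_compat_l;
    [pose proof (Cmod_ge_0 h); nra|].
  assert (0 < Cmod z * Cmod z) by nra.
  apply Rinv_le_contravar; [nra|apply Rmult_le_compat_l; lra].
- right; field; lra.
Qed.

Lemma has_cderiv_div (f g : C -> C) (z l m : C) :
  g z <> 0 -> has_cderiv f z l -> has_cderiv g z m ->
  has_cderiv (fun x => f x / g x)%C z ((l * g z - f z * m) / (g z * g z))%C.
Proof.
intros Hgz Hf Hg.
pose proof (has_cderiv_mult _ _ _ _ _ Hf
  (has_cderiv_comp _ _ _ _ _ (has_cderiv_inv _ Hgz) Hg)) as H.
replace ((l * g z - f z * m) / (g z * g z))%C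
  with (l * / g z + f z * (- / (g z * g z) * m))%C by (field; exact Hgz).
exact H.
Qed.

(** Bridge to real analysis: composing with a ray and with the real functional Re (c x) gives a real
    function to which mean value and maximum arguments apply. *)
Lemma has_cderiv_ray (f : C -> C) (c u l : C) (t : R) :
  has_cderiv f (RtoC t * u)%C l ->
  is_derive (fun s : R => Re (c * f (RtoC s * u)%C)%C) t (Re (c * (l * u))%C).
Proof.
intros H; apply is_derive_Reals; intros eps Heps.
set (k := Cmod c * Cmod u + 1).
assert (Hk : 0 < k)
  by (unfold k; pose proof (Cmod_ge_0 c); pose proof (Cmod_ge_0 u); nra).
destruct (H (eps / (2 * k))) as [d [Hd Hl]];
  [apply Rdiv_lt_0_compat; lra|].
pose proof (Cmod_ge_0 u) as Hu; pose proof (Cmod_ge_0 c) as Hc.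
assert (Hd' : 0 < d / (Cmod u + 1)) by (apply Rdiv_lt_0_compat; lra).
exists (mkposreal _ Hd'); intros h Hh0 Hh; simpl in Hh.
assert (P := Rabs_pos_lt _ Hh0).
apply Rlt_div_r in Hh; [|lra].
assert (Hhu : Cmod (RtoC h * u) = Rabs h * Cmod u) by (rewrite Cmod_mult, Cmod_R; ring).
specialize (Hl (RtoC h * u)%C).
rewrite Hhu in Hl.
assert (Hs : Rabs h * Cmod u < d) by (revert Hh; unfold minus, plus, opp; simpl; nra).
specialize (Hl Hs).
replace ((Re (c * f (RtoC (t + h) * u)%C)%C - Re (c * f (RtoC t * u)%C)%C) / h
   - Re (c * (l * u))%C)
 with (Re (c * (f (RtoC t * u + RtoC h * u) - f (RtoC t * u) - l * (RtoC h * u)))%C / h).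
2:{ replace (RtoC t * u + RtoC h * u)%C with (RtoC (t + h) * u)%C
      by (rewrite RtoC_plus; ring).
    generalize (f (RtoC (t + h) * u)%C) (f (RtoC t * u)%C); intros x y.
    destruct c, u, l, x, y; simpl; field; exact Hh0. }
unfold Rdiv; rewrite Rabs_mult, Rabs_inv.
apply Rlt_div_l; [exact P|].
eapply Rle_lt_trans; [apply re_le_Cmod|]; rewrite Cmod_mult.
apply Rle_lt_trans with (Cmod c * (eps / (2 * k) * (Rabs h * Cmod u))).
{ apply Rmult_le_compat_l; assumption. }
replace (Cmod c * (eps / (2 * k) * (Rabs h * Cmod u)))
  with (eps * Rabs h * ((Cmod c * Cmod u) / (2 * k))) by (field; lra).
assert (Cmod c * Cmod u / (2 * k) < 1)
  by (apply Rlt_div_l; [lra|]; unfold k; nra).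
assert (0 < eps * Rabs h) by nra.
nra.
Qed.

(** * Goursat's theorem for closed real 1-forms *)

Lemma RInt_near_const (f : R -> R) (a b m M : R) :
  a <= b -> ex_RInt f a b ->
  (forall t, a <= t <= b -> Rabs (f t - m) <= M) ->
  Rabs (RInt f a b - m * (b - a)) <= M * (b - a).
Proof.
intros Hab Hf H.
assert (E : forall c : R, RInt (fun _ => c) a b = c * (b - a)).
{ intros c; rewrite RInt_const; unfold scal; simpl; unfold mult; simpl; ring. }
assert (RInt f a b <= RInt (fun _ => m + M) a b).
{ apply RInt_le; [exact Hab|exact Hf|apply ex_RInt_const|].
  intros x Hx; specialize (H x ltac:(lra)); apply Rabs_le_between in H; lra. }
assert (RInt (fun _ => m - M) a b <= RInt f a b).
{ apply RInt_le; [exact Hab|apply ex_RInt_const|exact Hf|].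
  intros x Hx; specialize (H x ltac:(lra)); apply Rabs_le_between in H; lra. }
rewrite E in *; apply Rabs_le_between; lra.
Qed.

(* [(P, Q)] stands for the 1-form [P dx + Q dy]. *)
Definition circulation (P Q : R -> R -> R) (a a' b b' : R) : R :=
  RInt (fun t => P t b) a a' - RInt (fun t => P t b') a a'
  + RInt (fun t => Q a' t) b b' - RInt (fun t => Q a t) b b'.

(** Total differentiability at the point with equal cross derivatives. Continuity of the derivatives
    is left out, since complex differentiability does not supply it a priori. *)
Definition closed_at (P Q : R -> R -> R) (x y : R) : Prop :=
  exists px py qx qy : R,
    differentiable_pt_lim P x y px py /\
    differentiable_pt_lim Q x y qx qy /\ py = qx.

Lemma differentiable_continuous_x (P : R -> R -> R) (x y px py : R) :
  differentiable_pt_lim P x y px py -> continuous (fun t => P t y) x.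
Proof.
intros H; apply continuity_pt_filterlim, derivable_continuous_pt.
pose proof (derivable_pt_lim_comp_2d P (fun t => t) (fun _ => y) x px py 1 0 H
  (derivable_pt_lim_id x) (derivable_pt_lim_const y x)) as D.
eexists; exact D.
Qed.

Lemma differentiable_continuous_y (P : R -> R -> R) (x y px py : R) :
  differentiable_pt_lim P x y px py -> continuous (fun t => P x t) y.
Proof.
intros H; apply continuity_pt_filterlim, derivable_continuous_pt.
pose proof (derivable_pt_lim_comp_2d P (fun _ => x) (fun t => t) y px py 0 1 H
  (derivable_pt_lim_const x y) (derivable_pt_lim_id y)) as D.
eexists; exact D.
Qed.

Lemma closed_ex_RInt_x (P Q : R -> R -> R) (a a' y : R) :
  a <= a' -> (forall x, a <= x <= a' -> closed_at P Q x y) ->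
  ex_RInt (fun t => P t y) a a'.
Proof.
intros Ha H; apply (@ex_RInt_continuous R_CompleteNormedModule); intros x.
rewrite Rmin_left, Rmax_right by lra; intros Hx.
destruct (H x Hx) as (px & py & qx & qy & HP & _).
exact (differentiable_continuous_x _ _ _ _ _ HP).
Qed.

Lemma closed_ex_RInt_y (P Q : R -> R -> R) (b b' x : R) :
  b <= b' -> (forall y, b <= y <= b' -> closed_at P Q x y) ->
  ex_RInt (fun t => Q x t) b b'.
Proof.
intros Hb H; apply (@ex_RInt_continuous R_CompleteNormedModule); intros y.
rewrite Rmin_left, Rmax_right by lra; intros Hy.
destruct (H y Hy) as (px & py & qx & qy & _ & HQ & _).
exact (differentiable_continuous_y _ _ _ _ _ HQ).
Qed.

Definition closed_on (P Q : R -> R -> R) (a a' b b' : R) : Prop :=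
  forall x y, a <= x <= a' -> b <= y <= b' -> closed_at P Q x y.

(** Each inner side is traversed twice in opposite directions. *)
Lemma circulation_split (P Q : R -> R -> R) (a m a' b n b' : R) :
  a <= m <= a' -> b <= n <= b' -> closed_on P Q a a' b b' ->
  circulation P Q a a' b b' =
    circulation P Q a m b n + circulation P Q m a' b n
    + circulation P Q a m n b' + circulation P Q m a' n b'.
Proof.
intros Hm Hn H.
assert (X : forall y, b <= y <= b' ->
  RInt (fun t => P t y) a a' = RInt (fun t => P t y) a m + RInt (fun t => P t y) m a').
{ intros y Hy; symmetry; apply (RInt_Chasles (V := R_CompleteNormedModule));
  eapply closed_ex_RInt_x; try lra; intros x Hx; apply H; lra. }
assert (Y : forall x, a <= x <= a' ->
  RInt (fun t => Q x t) b b' = RInt (fun t => Q x t) b n + RInt (fun t => Q x t) n b').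
{ intros x Hx; symmetry; apply (RInt_Chasles (V := R_CompleteNormedModule));
  eapply closed_ex_RInt_y; try lra; intros y Hy; apply H; lra. }
unfold circulation.
rewrite (X b), (X b'), (Y a), (Y a') by lra; ring.
Qed.

Lemma differentiable_estimate (P : R -> R -> R) (x y px py eps : R) :
  differentiable_pt_lim P x y px py -> 0 < eps ->
  exists d, 0 < d /\ forall s u v, 0 <= s < d -> Rabs (u - x) <= s -> Rabs (v - y) <= s ->
    Rabs (P u v - P x y - (px * (u - x) + py * (v - y))) <= eps * s.
Proof.
intros H Heps; destruct (H (mkposreal _ Heps)) as [d Hd].
exists d; split; [apply cond_pos|]; intros s u v Hs Hu Hv.
eapply Rle_trans; [apply Hd; lra|]; simpl.
apply Rmult_le_compat_l; [lra|]; apply Rmax_lub; assumption.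
Qed.

(** In the linear approximation at (x, y), opposite sides cancel up to (qx - py) h k, which
    vanishes. Only the errors remain: at most eps (h + k) pointwise on each side, and the sides have
    total length 2 (h + k). *)
Lemma circulation_small (P Q : R -> R -> R) (x y eps : R) :
  closed_at P Q x y -> 0 < eps ->
  exists d, 0 < d /\
    forall a b h k, 0 <= h -> 0 <= k -> h + k < d ->
      a <= x <= a + h -> b <= y <= b + k ->
      closed_on P Q a (a + h) b (b + k) ->
      Rabs (circulation P Q a (a + h) b (b + k)) <= 2 * eps * (h + k) ^ 2.
Proof.
intros (px & py & qx & qy & HP & HQ & E) Heps; subst py.
destruct (differentiable_estimate _ _ _ _ _ _ HP Heps) as [d1 [P1 L1]].
destruct (differentiable_estimate _ _ _ _ _ _ HQ Heps) as [d2 [P2 L2]].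
exists (Rmin d1 d2); split; [apply Rmin_glb_lt; assumption|].
intros a b h k Hh Hk Hs Hx Hy H.
pose proof (Rmin_l d1 d2); pose proof (Rmin_r d1 d2).
assert (XP : forall v, b <= v <= b + k -> ex_RInt (fun t => P t v) a (a + h)).
{ intros v Hv; eapply closed_ex_RInt_x; [lra|]; intros t Ht; apply H; lra. }
assert (XQ : forall u, a <= u <= a + h -> ex_RInt (fun t => Q u t) b (b + k)).
{ intros u Hu; eapply closed_ex_RInt_y; [lra|]; intros t Ht; apply H; lra. }
assert (IP : Rabs (RInt (fun t => P t b - P t (b + k)) a (a + h) - (- qx * k) * (a + h - a))
             <= 2 * eps * (h + k) * (a + h - a)).
{ apply RInt_near_const; [lra| |].
  - apply (@ex_RInt_minus R_NormedModule); apply XP; lra.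
  - intros t Ht.
    pose proof (L1 (h + k) t b ltac:(lra) ltac:(apply Rabs_le; lra) ltac:(apply Rabs_le; lra)) as A1.
    pose proof (L1 (h + k) t (b + k) ltac:(lra) ltac:(apply Rabs_le; lra) ltac:(apply Rabs_le; lra)) as A2.
    apply Rabs_le_between in A1; apply Rabs_le_between in A2; apply Rabs_le; lra. }
assert (IQ : Rabs (RInt (fun t => Q (a + h) t - Q a t) b (b + k) - (qx * h) * (b + k - b))
             <= 2 * eps * (h + k) * (b + k - b)).
{ apply RInt_near_const; [lra| |].
  - apply (@ex_RInt_minus R_NormedModule); apply XQ; lra.
  - intros t Ht.
    pose proof (L2 (h + k) a t ltac:(lra) ltac:(apply Rabs_le; lra) ltac:(apply Rabs_le; lra)) as A1.
    pose proof (L2 (h + k) (a + h) t ltac:(lra) ltac:(apply Rabs_le; lra) ltac:(apply Rabs_le; lra)) as A2.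
    apply Rabs_le_between in A1; apply Rabs_le_between in A2; apply Rabs_le; lra. }
pose proof (@RInt_minus R_CompleteNormedModule (fun t => P t b) (fun t => P t (b + k)) a (a + h)
  (XP b ltac:(lra)) (XP (b + k) ltac:(lra))) as EP.
pose proof (@RInt_minus R_CompleteNormedModule (fun t => Q (a + h) t) (fun t => Q a t) b (b + k)
  (XQ (a + h) ltac:(lra)) (XQ a ltac:(lra))) as EQ.
unfold minus, plus, opp in EP, EQ; simpl in EP, EQ.
unfold Rminus in IP at 2; unfold Rminus in IQ at 2.
change (RInt (fun t => P t b + - P t (b + k)) a (a + h)
        = RInt (fun t => P t b) a (a + h) + - RInt (fun t => P t (b + k)) a (a + h)) in EP.
change (RInt (fun t => Q (a + h) t + - Q a t) b (b + k)
        = RInt (fun t => Q (a + h) t) b (b + k) + - RInt (fun t => Q a t) b (b + k)) in EQ.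
rewrite EP in IP; rewrite EQ in IQ; unfold circulation.
apply Rabs_le_between in IP; apply Rabs_le_between in IQ; apply Rabs_le; nra.
Qed.

(** Lower left corner of a quarter with circulation above eps. The comparison of reals is decided by
    [Rlt_dec], so the bisection is a plain recursive function; the fourth quarter is the default. *)
Definition goursat_step (P Q : R -> R -> R) (h k eps : R) (p : R * R) : R * R :=
  let bad x y := Rlt_dec eps (Rabs (circulation P Q x (x + h) y (y + k))) in
  let (a, b) := p in
  if bad a b then (a, b) else
  if bad (a + h) b then (a + h, b) else
  if bad a (b + k) then (a, b + k) else (a + h, b + k).

Fixpoint goursat_corner (P Q : R -> R -> R) (a b h k eps : R) (n : nat) : R * R :=
  match n with
  | O => (a, b)
  | S n => goursat_step P Q (h / 2 ^ S n) (k / 2 ^ S n) (eps / 4 ^ S n)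
             (goursat_corner P Q a b h k eps n)
  end.

(** Pigeonhole: four circulations of modulus at most eps cannot add up to more than 4 eps. *)
Lemma goursat_step_spec (P Q : R -> R -> R) (h k eps a b : R) :
  0 <= h -> 0 <= k ->
  closed_on P Q a (a + 2 * h) b (b + 2 * k) ->
  4 * eps < Rabs (circulation P Q a (a + 2 * h) b (b + 2 * k)) ->
  let p := goursat_step P Q h k eps (a, b) in
  (a <= fst p <= a + h) /\ (b <= snd p <= b + k) /\
  eps < Rabs (circulation P Q (fst p) (fst p + h) (snd p) (snd p + k)).
Proof.
intros Hh Hk H Hb; unfold goursat_step.
rewrite (circulation_split P Q a (a + h) (a + 2 * h) b (b + k) (b + 2 * k)) in Hb
  by first [exact H | split; lra].
replace (a + 2 * h) with (a + h + h) in Hb by ring.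
replace (b + 2 * k) with (b + k + k) in Hb by ring.
cbv zeta.
destruct Rlt_dec as [L1|L1]; [simpl; repeat split; lra|].
destruct Rlt_dec as [L2|L2]; [simpl; repeat split; lra|].
destruct Rlt_dec as [L3|L3]; [simpl; repeat split; lra|].
simpl; repeat split; try lra.
destruct (Rlt_dec eps (Rabs (circulation P Q (a + h) (a + h + h) (b + k) (b + k + k))));
  [assumption|].
exfalso; revert Hb; apply Rle_not_lt.
repeat (eapply Rle_trans; [apply Rabs_triang|]).
pose proof (Rabs_triang (circulation P Q a (a + h) b (b + k)) (circulation P Q (a + h) (a + h + h) b (b + k))).
pose proof (Rabs_triang (circulation P Q a (a + h) b (b + k) + circulation P Q (a + h) (a + h + h) b (b + k))
  (circulation P Q a (a + h) (b + k) (b + k + k))).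
lra.
Qed.

Lemma scaled_pow2_lim (c : R) : is_lim_seq (fun n => c / 2 ^ n) 0.
Proof.
apply is_lim_seq_ext with (fun n => c * (/ 2) ^ n).
{ intros n; rewrite pow_inv; reflexivity. }
replace (Finite 0) with (Rbar_mult c 0) by (simpl; f_equal; ring).
apply is_lim_seq_scal_l, is_lim_seq_geom; rewrite Rabs_pos_eq; lra.
Qed.

Lemma nested_intervals_point (u : nat -> R) (c : R) :
  0 <= c ->
  (forall n, u n <= u (S n) <= u n + c / 2 ^ S n) ->
  exists x, forall n, u n <= x <= u n + c / 2 ^ n.
Proof.
intros Hc H.
assert (P2 : forall n, 0 < 2 ^ n) by (intros; apply pow_lt; lra).
assert (C2 : forall n, c / 2 ^ n = c / 2 ^ S n + c / 2 ^ S n).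
{ intros n; simpl; pose proof (P2 n); field; lra. }
assert (N : forall n, 0 <= c / 2 ^ n).
{ intros n; apply Rdiv_le_0_compat; auto. }
assert (U : forall n m, u n <= u (n + m)%nat /\
               u (n + m)%nat + c / 2 ^ (n + m) <= u n + c / 2 ^ n).
{ intros n m; induction m as [|m IH]; [rewrite Nat.add_0_r; lra|].
  rewrite Nat.add_succ_r; specialize (H (n + m)%nat); rewrite (C2 (n + m)%nat) in IH; lra. }
assert (L : ex_finite_lim_seq u).
{ apply ex_finite_lim_seq_incr with (u 0%nat + c / 2 ^ 0); [apply H|].
  intros n; destruct (U 0%nat n) as [_ U0]; change (0 + n)%nat with n in U0; pose proof (N n); lra. }
destruct L as [x Lx]; exists x; intros n; split.
- apply (is_lim_seq_incr_compare u); [exact Lx|apply H].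
- apply (is_lim_seq_incr_n u n) in Lx.
  change (Rbar_le x (u n + c / 2 ^ n)).
  apply (is_lim_seq_le (fun m => u (m + n)%nat) (fun _ => u n + c / 2 ^ n));
    [|exact Lx|apply is_lim_seq_const].
  intros m; destruct (U n m); rewrite (Nat.add_comm m n); pose proof (N (n + m)%nat); lra.
Qed.

(** A nonzero circulation would stay above a constant times 4^-n on nested quarters, whereas near
    their common point [circulation_small] makes it a smaller multiple of 4^-n. *)
Lemma goursat (P Q : R -> R -> R) (a b h k : R) :
  0 <= h -> 0 <= k ->
  closed_on P Q a (a + h) b (b + k) ->
  circulation P Q a (a + h) b (b + k) = 0.
Proof.
intros Hh Hk H.
destruct (Req_dec (circulation P Q a (a + h) b (b + k)) 0) as [|N]; [assumption|exfalso].
assert (HN := Rabs_pos_lt _ N).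
(* Half the circulation, so that the strict inequality propagated by the bisection holds at level
   0. *)
set (eps := Rabs (circulation P Q a (a + h) b (b + k)) / 2).
assert (Heps : 0 < eps) by (unfold eps; lra).
set (p := goursat_corner P Q a b h k eps).
assert (P2 : forall n, 0 < 2 ^ n) by (intros; apply pow_lt; lra).
assert (P4 : forall n, 0 < 4 ^ n) by (intros; apply pow_lt; lra).
assert (C2 : forall c n, c / 2 ^ n = 2 * (c / 2 ^ S n)).
{ intros c n; simpl; pose proof (P2 n); field; lra. }
assert (C4 : forall c n, c / 4 ^ n = 4 * (c / 4 ^ S n)).
{ intros c n; simpl; pose proof (P4 n); field; lra. }
assert (N2 : forall c n, 0 <= c -> 0 <= c / 2 ^ n).
{ intros; apply Rdiv_le_0_compat; auto. }
assert (I : forall n,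
  (a <= fst (p n) /\ fst (p n) + h / 2 ^ n <= a + h) /\
  (b <= snd (p n) /\ snd (p n) + k / 2 ^ n <= b + k) /\
  eps / 4 ^ n < Rabs (circulation P Q (fst (p n)) (fst (p n) + h / 2 ^ n)
                        (snd (p n)) (snd (p n) + k / 2 ^ n)) /\
  (fst (p n) <= fst (p (S n)) <= fst (p n) + h / 2 ^ S n) /\
  (snd (p n) <= snd (p (S n)) <= snd (p n) + k / 2 ^ S n) /\
  eps / 4 ^ S n < Rabs (circulation P Q (fst (p (S n))) (fst (p (S n)) + h / 2 ^ S n)
                        (snd (p (S n))) (snd (p (S n)) + k / 2 ^ S n))).
{ assert (St : forall n,
    (a <= fst (p n) /\ fst (p n) + h / 2 ^ n <= a + h) /\
    (b <= snd (p n) /\ snd (p n) + k / 2 ^ n <= b + k) /\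
    eps / 4 ^ n < Rabs (circulation P Q (fst (p n)) (fst (p n) + h / 2 ^ n)
                        (snd (p n)) (snd (p n) + k / 2 ^ n)) ->
    (fst (p n) <= fst (p (S n)) <= fst (p n) + h / 2 ^ S n) /\
    (snd (p n) <= snd (p (S n)) <= snd (p n) + k / 2 ^ S n) /\
    eps / 4 ^ S n < Rabs (circulation P Q (fst (p (S n))) (fst (p (S n)) + h / 2 ^ S n)
                        (snd (p (S n))) (snd (p (S n)) + k / 2 ^ S n))).
  { intros n (X & Y & Z).
    rewrite (C2 h n) in X, Z; rewrite (C2 k n) in Y, Z; rewrite (C4 eps n) in Z.
    assert (Ep : p (S n) = goursat_step P Q (h / 2 ^ S n) (k / 2 ^ S n) (eps / 4 ^ S n)
       (fst (p n), snd (p n))).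
    { rewrite <- surjective_pairing; reflexivity. }
    rewrite Ep; apply goursat_step_spec; auto.
    intros x y Hx Hy; apply H; lra. }
  intros n; induction n as [|n IH].
  - assert (B0 : (a <= fst (p 0%nat) /\ fst (p 0%nat) + h / 2 ^ 0 <= a + h) /\
    (b <= snd (p 0%nat) /\ snd (p 0%nat) + k / 2 ^ 0 <= b + k) /\
    eps / 4 ^ 0 < Rabs (circulation P Q (fst (p 0%nat)) (fst (p 0%nat) + h / 2 ^ 0)
                        (snd (p 0%nat)) (snd (p 0%nat) + k / 2 ^ 0))).
    { simpl; rewrite !Rdiv_1_r; repeat split; try lra; unfold eps; lra. }
    pose proof (St _ B0); tauto.
  - destruct IH as (X & Y & Z & X' & Y' & Z').
    rewrite (C2 h n) in X; rewrite (C2 k n) in Y.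
    assert (B0 : (a <= fst (p (S n)) /\ fst (p (S n)) + h / 2 ^ S n <= a + h) /\
    (b <= snd (p (S n)) /\ snd (p (S n)) + k / 2 ^ S n <= b + k) /\
    eps / 4 ^ S n < Rabs (circulation P Q (fst (p (S n))) (fst (p (S n)) + h / 2 ^ S n)
                        (snd (p (S n))) (snd (p (S n)) + k / 2 ^ S n))).
    { repeat split; try lra; exact Z'. }
    pose proof (St _ B0); tauto. }
destruct (nested_intervals_point (fun n => fst (p n)) h Hh) as [x Hx]; [apply I|].
destruct (nested_intervals_point (fun n => snd (p n)) k Hk) as [y Hy]; [apply I|].
assert (Hxy : closed_at P Q x y).
{ apply H; [specialize (Hx 0%nat)|specialize (Hy 0%nat)];
    simpl in *; rewrite Rdiv_1_r in *; lra. }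
(* Chosen so that 2 e ((h + k) / 2^n)^2 <= eps / 4^n; the + 1 covers the degenerate rectangle h = k
   = 0. *)
set (e := eps / (2 * (h + k + 1) ^ 2)).
assert (He : 0 < e) by (apply Rdiv_lt_0_compat; nra).
destruct (circulation_small P Q x y e Hxy He) as [d [Hd L]].
destruct (proj1 (is_lim_seq_Reals _ _) (scaled_pow2_lim (h + k)) d Hd) as [n Hn].
specialize (Hn n (le_n n)); unfold Rdist in Hn; rewrite Rminus_0_r in Hn.
apply Rabs_def2 in Hn; destruct Hn as [Hn _].
destruct (I n) as (X & Y & Z & _).
assert (E : h / 2 ^ n + k / 2 ^ n = (h + k) / 2 ^ n) by (field; pose proof (P2 n); lra).
specialize (L (fst (p n)) (snd (p n)) (h / 2 ^ n) (k / 2 ^ n) (N2 h n Hh) (N2 k n Hk)).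
rewrite E in L; specialize (L Hn (Hx n) (Hy n)).
assert (Hc : closed_on P Q (fst (p n)) (fst (p n) + h / 2 ^ n) (snd (p n)) (snd (p n) + k / 2 ^ n)).
{ intros u v Hu Hv; apply H; lra. }
specialize (L Hc); revert Z; apply Rle_not_lt; eapply Rle_trans; [exact L|].
assert (E4 : 4 ^ n = 2 ^ n * 2 ^ n) by (rewrite <- Rpow_mult_distr; f_equal; ring).
rewrite E4; unfold e; pose proof (P2 n).
replace (2 * (eps / (2 * (h + k + 1) ^ 2)) * ((h + k) / 2 ^ n) ^ 2)
  with (eps / (2 ^ n * 2 ^ n) * ((h + k) ^ 2 / (h + k + 1) ^ 2)) by (field; lra).
assert (0 < eps / (2 ^ n * 2 ^ n)) by (apply Rdiv_lt_0_compat; nra).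
assert ((h + k) ^ 2 / (h + k + 1) ^ 2 <= 1) by (apply Rle_div_l; nra).
nra.
Qed.

(** * Maximum modulus and the Schwarz lemma *)

Lemma differentiable_pt_lim_snd (f : R -> R) (x y l : R) :
  derivable_pt_lim f y l -> differentiable_pt_lim (fun _ v => f v) x y 0 l.
Proof.
intros H eps; destruct (H eps (cond_pos eps)) as [d Hd].
exists d; intros u v _ Hv.
destruct (Req_dec v y) as [->|N].
{ replace (f y - f y - (0 * (u - x) + l * (y - y))) with 0 by ring.
  rewrite Rabs_R0; apply Rmult_le_pos; [apply Rlt_le, cond_pos|].
  eapply Rle_trans; [apply Rabs_pos|apply Rmax_l]. }
assert (Hn : v - y <> 0) by lra.
specialize (Hd (v - y) Hn Hv).
replace (y + (v - y)) with v in Hd by ring.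
replace (f v - f y - (0 * (u - x) + l * (v - y)))
  with (((f v - f y) / (v - y) - l) * (v - y)) by (field; exact Hn).
rewrite Rabs_mult; apply Rmult_le_compat; try apply Rabs_pos; [lra|apply Rmax_r].
Qed.

Lemma differentiable_pt_lim_mult (x y : R) :
  differentiable_pt_lim Rmult x y y x.
Proof.
intros eps; exists eps; intros u v Hu Hv.
replace (u * v - x * y - (y * (u - x) + x * (v - y)))
  with ((u - x) * (v - y)) by ring.
rewrite Rabs_mult; apply Rmult_le_compat; try apply Rabs_pos; [lra|apply Rmax_r].
Qed.

Lemma has_cderiv_differentiable (g : C -> C) (x y : R) (l : C) :
  has_cderiv g (x, y) l ->
  differentiable_pt_lim (fun u v => Re (g (u, v))) x y (Re l) (- Im l) /\
  differentiable_pt_lim (fun u v => Im (g (u, v))) x y (Im l) (Re l).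
Proof.
intros H.
assert (K : forall eps : posreal, exists d : posreal, forall u v,
  Rabs (u - x) < d -> Rabs (v - y) < d ->
  Cmod (g (u, v) - g (x, y) - l * ((u - x)%R, (v - y)%R))%C
    <= eps * Rmax (Rabs (u - x)) (Rabs (v - y))).
(* The halving absorbs the factor 2 in the bound of the modulus by the larger coordinate. *)
{ intros eps; destruct (H (eps / 2)) as [d [Hd Hl]];
    [pose proof (cond_pos eps); lra|].
  assert (Hd2 : 0 < d / 2) by lra.
  exists (mkposreal _ Hd2); simpl; intros u v Hu Hv.
  assert (B : Cmod (u - x, v - y) <= 2 * Rmax (Rabs (u - x)) (Rabs (v - y))).
  { eapply Rle_trans; [apply Cmod_2Rmax|]; simpl.
    apply Rmult_le_compat_r; [eapply Rle_trans; [apply Rabs_pos|apply Rmax_l]|].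
    rewrite <- (sqrt_square 2) at 2 by lra; apply sqrt_le_1; lra. }
  specialize (Hl (u - x, v - y)).
  assert (E : ((x, y) + ((u - x)%R, (v - y)%R))%C = (u, v))
    by (apply injective_projections; simpl; ring).
  rewrite E in Hl; pose proof (cond_pos eps).
  eapply Rle_trans; [apply Hl|nra].
  eapply Rle_lt_trans; [exact B|].
  assert (Rmax (Rabs (u - x)) (Rabs (v - y)) < d / 2) by (apply Rmax_lub_lt; assumption).
  lra. }
split; intros eps; destruct (K eps) as [d Hd]; exists d; intros u v Hu Hv;
  (eapply Rle_trans; [|exact (Hd u v Hu Hv)]).
- eapply Rle_trans; [right|apply re_le_Cmod]; f_equal.
  destruct l as [l1 l2], (g (u, v)), (g (x, y)); simpl; ring.
- eapply Rle_trans; [right|eapply Rle_trans; [apply Rmax_r|apply Rmax_Cmod]]; f_equal.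
  destruct l as [l1 l2], (g (u, v)), (g (x, y)); simpl; ring.
Qed.

(* In polar coordinates the Cauchy-Riemann equations say that
   [Im g / r dr + Re g dt] is closed. *)
Lemma polar_closed (g : C -> C) (r t : R) (l : C) :
  r <> 0 -> has_cderiv g (r * cos t, r * sin t) l ->
  closed_at (fun r t => Im (g (r * cos t, r * sin t)) * / r)
            (fun r t => Re (g (r * cos t, r * sin t))) r t.
Proof.
intros Hr H.
destruct (has_cderiv_differentiable _ _ _ _ H) as [HR HI].
assert (Dr : differentiable_pt_lim (fun u _ => u) r t 1 0).
{ apply (differentiable_pt_lim_proj1_0 (fun u => u)), derivable_pt_lim_id. }
assert (DX : differentiable_pt_lim (fun u v => u * cos v) r t
               (cos t * 1 + r * 0) (cos t * 0 + r * - sin t)).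
{ apply (differentiable_pt_lim_comp Rmult (fun u _ => u) (fun _ v => cos v));
    [apply differentiable_pt_lim_mult|exact Dr|].
  apply differentiable_pt_lim_snd, derivable_pt_lim_cos. }
assert (DY : differentiable_pt_lim (fun u v => u * sin v) r t
               (sin t * 1 + r * 0) (sin t * 0 + r * cos t)).
{ apply (differentiable_pt_lim_comp Rmult (fun u _ => u) (fun _ v => sin v));
    [apply differentiable_pt_lim_mult|exact Dr|].
  apply differentiable_pt_lim_snd, derivable_pt_lim_sin. }
pose proof (differentiable_pt_lim_comp _ _ _ _ _ _ _ _ _ _ _ HR DX DY) as DU.
pose proof (differentiable_pt_lim_comp _ _ _ _ _ _ _ _ _ _ _ HI DX DY) as DV.
assert (Di : differentiable_pt_lim (fun u _ => / u) r t (- 1 / r ^ 2) 0).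
{ apply (differentiable_pt_lim_proj1_0 Rinv).
  apply is_derive_Reals; auto_derive; [exact Hr|field; exact Hr]. }
pose proof (differentiable_pt_lim_comp Rmult _ _ _ _ _ _ _ _ _ _
  (differentiable_pt_lim_mult _ _) DV Di) as DP.
do 4 eexists; split; [exact DP|split; [exact DU|]].
field; exact Hr.
Qed.

Lemma Cmod_polar (r t : R) : 0 <= r -> Cmod (r * cos t, r * sin t) = r.
Proof.
intros Hr; unfold Cmod; simpl.
replace (r * cos t * (r * cos t * 1) + r * sin t * (r * sin t * 1))
  with (r * r * ((sin t)² + (cos t)²)) by (unfold Rsqr; ring).
rewrite sin2_cos2, Rmult_1_r; apply sqrt_square; exact Hr.
Qed.

(** Goursat on the polar rectangle [s, 1] x [0, 2 pi]: the sides at angles 0 and 2 pi cancel by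
    periodicity, so Re g has the same mean on the circles of radius s and 1. The inner radius s
    stays positive because of the factor 1 / r, and is small enough for continuity at 0 to give the
    mean up to eps. *)
Lemma mean_value_le (g : C -> C) (M : R) :
  (forall z, Cmod z <= 1 -> exists l, has_cderiv g z l) ->
  (forall z, Cmod z = 1 -> Re (g z) <= M) ->
  Re (g (RtoC 0)) <= M.
Proof.
intros Hg HM; apply le_epsilon; intros eps Heps.
destruct (Hg (RtoC 0)) as [l0 H0]; [rewrite Cmod_0; lra|].
destruct (has_cderiv_continuous _ _ _ H0 eps Heps) as [d [Hd Hc]].
set (s := Rmin (d / 2) (1 / 2)).
assert (Hs : 0 < s <= 1 / 2)
  by (split; [apply Rmin_glb_lt; lra|apply Rmin_r]).
assert (Hsd : s < d) by (pose proof (Rmin_l (d / 2) (1 / 2)); fold s in H; lra).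
set (P := fun r t => Im (g (r * cos t, r * sin t)) * / r).
set (Q := fun r t => Re (g (r * cos t, r * sin t))).
pose proof PI_RGT_0 as Hpi.
assert (Hcl : closed_on P Q s (s + (1 - s)) 0 (0 + 2 * PI)).
{ intros r t Hr _.
  destruct (Hg (r * cos t, r * sin t)) as [l Hl]; [rewrite Cmod_polar; lra|].
  apply polar_closed with l; [lra|exact Hl]. }
pose proof (goursat P Q s 0 (1 - s) (2 * PI) ltac:(lra) ltac:(lra) Hcl) as G.
unfold circulation in G.
assert (E : RInt (fun t => P t 0) s (s + (1 - s))
            = RInt (fun t => P t (0 + 2 * PI)) s (s + (1 - s))).
{ apply RInt_ext; intros t _; unfold P.
  rewrite Rplus_0_l, cos_2PI, sin_2PI, cos_0, sin_0; reflexivity. }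
assert (XQ : forall r, s <= r <= 1 -> ex_RInt (fun t => Q r t) 0 (0 + 2 * PI)).
{ intros r Hr; eapply closed_ex_RInt_y; [lra|]; intros y Hy; apply Hcl; lra. }
assert (C0 : forall c : R, RInt (fun _ => c) 0 (0 + 2 * PI) = 2 * PI * c).
{ intros c; rewrite RInt_const; unfold scal; simpl; unfold mult; simpl; ring. }
assert (U1 : RInt (fun t => Q (s + (1 - s)) t) 0 (0 + 2 * PI) <= 2 * PI * M).
{ rewrite <- C0; apply RInt_le; [lra|apply XQ; lra|apply ex_RInt_const|].
  intros t _; apply HM; rewrite Cmod_polar; lra. }
assert (U2 : 2 * PI * (Re (g (RtoC 0)) - eps) <= RInt (fun t => Q s t) 0 (0 + 2 * PI)).
{ rewrite <- C0; apply RInt_le; [lra|apply ex_RInt_const|apply XQ; lra|].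
  intros t _; specialize (Hc (s * cos t, s * sin t)).
  rewrite Cmod_polar in Hc by lra; specialize (Hc Hsd).
  rewrite Cplus_0_l in Hc; unfold Q.
  revert Hc; generalize (g (s * cos t, s * sin t)) (g (RtoC 0)); intros x y Hc.
  pose proof (re_le_Cmod (x - y)%C) as R1; apply Rabs_le_between in R1.
  destruct x, y; simpl in *; lra. }
apply Rmult_le_reg_l with (2 * PI); [lra|]; lra.
Qed.

Lemma le_of_sqr_le (x y : R) : 0 <= y -> x ^ 2 <= y ^ 2 -> x <= y.
Proof. intros Hy H; destruct (Rle_lt_dec x y); [assumption|nra]. Qed.

(** For |b| < 1 this shows that (z + b) / (1 + conj(b) z) maps the closed unit disc into itself and
    the circle to the circle. *)
Lemma moebius_identity (b z : C) :
  Cmod (1 + Cconj b * z)%C ^ 2 - Cmod (z + b)%C ^ 2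
  = (1 - Cmod b ^ 2) * (1 - Cmod z ^ 2).
Proof.
rewrite !Cmod2_alt; destruct b as [b1 b2], z as [z1 z2]; simpl; ring.
Qed.

Lemma moebius_denominator (b z : C) :
  Cmod b < 1 -> Cmod z <= 1 -> (1 + Cconj b * z)%C <> 0.
Proof.
intros Hb Hz; apply Cmod_gt_0.
pose proof (Cmod_rev_triangle 1 (Cconj b * z)%C) as H.
rewrite Cmod_mult, Cmod_conj, Cmod_1 in H.
pose proof (Cmod_ge_0 b); pose proof (Cmod_ge_0 z); nra.
Qed.

(* The mean value inequality is moved to an arbitrary point by a Moebius map. *)
Lemma maximum_modulus (f : C -> C) (r M : R) (a : C) :
  0 < r < 1 -> (forall z, in_disc z -> exists l, has_cderiv f z l) ->
  (forall z, Cmod z = r -> Cmod (f z) <= M) -> Cmod a < r ->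
  Cmod (f a) <= M.
Proof.
intros Hr Hf HM Ha.
set (b := (a / RtoC r)%C).
assert (Hr0 : RtoC r <> 0) by (apply RtoC_neq; lra).
assert (Hb : Cmod b < 1).
{ unfold b; rewrite Cmod_div, Cmod_R, Rabs_pos_eq by (assumption || lra).
  apply Rlt_div_l; lra. }
pose proof (Cmod_ge_0 b) as Hb0.
set (psi := fun z => (RtoC r * ((z + b) / (1 + Cconj b * z)))%C).
assert (Hpsi : forall z, Cmod z <= 1 -> Cmod (psi z) <= r /\ (Cmod z = 1 -> Cmod (psi z) = r)).
{ intros z Hz; pose proof (moebius_denominator b z Hb Hz) as Hd.
  pose proof (proj1 (Cmod_gt_0 _) Hd) as Pd; pose proof (moebius_identity b z) as Id.
  pose proof (Cmod_ge_0 z); pose proof (Cmod_ge_0 (z + b)%C).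
  unfold psi; rewrite Cmod_mult, Cmod_R, Rabs_pos_eq, Cmod_div by (assumption || lra).
  split.
  - assert (Cmod (z + b)%C / Cmod (1 + Cconj b * z)%C <= 1)
      by (apply Rle_div_l; [exact Pd|]; rewrite Rmult_1_l; apply le_of_sqr_le; [lra|];
          assert (0 <= (1 - Cmod b ^ 2) * (1 - Cmod z ^ 2)) by (apply Rmult_le_pos; nra); lra).
    nra.
  - intros E; rewrite E in Id.
    replace (Cmod (z + b)%C) with (Cmod (1 + Cconj b * z)%C)
      by (apply Rle_antisym; apply le_of_sqr_le; lra).
    field; lra. }
(* With this factor Re (c f) equals |f a|^2 at a and is at most |f a| M on the circle. *)
set (c := Cconj (f a)).
assert (E0 : psi (RtoC 0) = a).
{ unfold psi; rewrite Cmult_0_r, Cplus_0_r, Cplus_0_l; unfold b; field; exact Hr0. }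
assert (Ec : Re (c * f a)%C = Cmod (f a) ^ 2).
{ rewrite Cmod2_alt; unfold c; destruct (f a); simpl; ring. }
assert (Hm : Re (c * f (psi (RtoC 0)))%C <= Cmod (f a) * M).
{ apply (mean_value_le (fun z => c * f (psi z))%C).
  - intros z Hz; destruct (Hpsi z Hz) as [Hz1 _].
    destruct (Hf (psi z)) as [l Hl]; [unfold in_disc; lra|].
    pose proof (moebius_denominator b z Hb Hz) as Hd.
    eexists; apply has_cderiv_scal; apply has_cderiv_comp with (g := psi); [exact Hl|].
    apply has_cderiv_scal; apply has_cderiv_div; [exact Hd| |].
    + apply has_cderiv_plus; [apply has_cderiv_id|apply has_cderiv_const].
    + apply has_cderiv_plus; [apply has_cderiv_const|apply has_cderiv_scal, has_cderiv_id].
  - intros z Hz; destruct (Hpsi z) as [_ Hz1]; [lra|].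
    eapply Rle_trans; [apply Rle_abs|]; eapply Rle_trans; [apply re_le_Cmod|].
    rewrite Cmod_mult; unfold c; rewrite Cmod_conj.
    apply Rmult_le_compat_l; [apply Cmod_ge_0|]; apply HM, Hz1, Hz. }
rewrite E0, Ec in Hm; pose proof (Cmod_ge_0 (f a)) as Hfa.
(* If f a = 0 there is nothing to cancel; M >= 0 is then read off at the point r of the circle. *)
destruct (Rle_lt_or_eq_dec _ _ Hfa) as [P|Z]; [nra|].
rewrite <- Z.
apply Rle_trans with (Cmod (f (RtoC r))); [apply Cmod_ge_0|].
apply HM; rewrite Cmod_R; apply Rabs_pos_eq; lra.
Qed.

(** The error splits as (u h - l h) (w h / h) + l (w h - m h), with w h / h bounded near 0. The
    conventional value of 0 / 0 is harmless because it is multiplied by u 0 = 0. *)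
Lemma has_cderiv_mult_quotient (u w : C -> C) (l m : C) :
  u (RtoC 0) = RtoC 0 -> w (RtoC 0) = RtoC 0 ->
  has_cderiv u 0 l -> has_cderiv w 0 m ->
  has_cderiv (fun z => u z * (w z / z))%C 0 (l * m)%C.
Proof.
intros U0 W0 Hu Hw.
destruct (has_cderiv_lipschitz _ _ _ Hw) as [d [Hd L]].
pose proof (Cmod_ge_0 m) as Pm.
assert (Q : little_o (fun h => (u (0 + h) - u 0 - l * h) * (w h / h))%C).
{ intros eps Heps.
  destruct (Hu (eps / (Cmod m + 1))) as [d' [Hd' L']]; [apply Rdiv_lt_0_compat; lra|].
  exists (Rmin d d'); split; [apply Rmin_glb_lt; assumption|]; intros h Hh.
  pose proof (L h (Rlt_le_trans _ _ _ Hh (Rmin_l _ _))) as L1.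
  pose proof (L' h (Rlt_le_trans _ _ _ Hh (Rmin_r _ _))) as L2.
  destruct (Ceq_dec h 0) as [->|N].
  - rewrite Cplus_0_r; replace (u 0 - u 0 - l * 0)%C with (RtoC 0) by ring.
    rewrite Cmult_0_l, Cmod_0; lra.
  - rewrite Cplus_0_l, W0 in L1; replace (w h - 0)%C with (w h) in L1 by ring.
    pose proof (proj1 (Cmod_gt_0 h) N) as Ph.
    rewrite Cmod_mult, Cmod_div by exact N.
    apply Rle_trans with (eps / (Cmod m + 1) * Cmod h * (Cmod m + 1)).
    + apply Rmult_le_compat; [apply Cmod_ge_0|apply Rdiv_le_0_compat; auto using Cmod_ge_0
        |exact L2|apply Rle_div_l; lra].
    + right; field; lra. }
eapply little_o_ext; [|exact (little_o_plus _ _ Q (little_o_scal l _ Hw))].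
intros h; simpl; rewrite !Cplus_0_l, U0, W0, (Cmult_0_l (0 / 0)).
destruct (Ceq_dec h 0) as [->|N]; [rewrite U0, W0; ring|field; exact N].
Qed.

Lemma pow_unbounded (q c : R) : 1 < q -> 0 < c -> exists n : nat, 1 < c * q ^ n.
Proof.
intros Hq Hc.
destruct (Pow_x_infinity q ltac:(rewrite Rabs_pos_eq; lra) (2 / c)) as [N HN].
exists N; specialize (HN N (le_n N)).
rewrite Rabs_pos_eq in HN by (apply pow_le; lra).
apply Rge_le, Rle_div_l in HN; [|exact Hc]; lra.
Qed.

(* Instead of removing the singularity of [w z / z], apply the maximum modulus
   principle to [w z * (w z / z) ^ n] and let [n] grow. *)
Lemma schwarz (w : C -> C) (a : C) :
  (forall z, in_disc z -> exists l, has_cderiv w z l) ->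
  w (RtoC 0) = RtoC 0 -> (forall z, in_disc z -> Cmod (w z) < 1) ->
  in_disc a -> Cmod (w a) <= Cmod a.
Proof.
intros Hw W0 W1 Ha; unfold in_disc in Ha.
destruct (Rle_lt_dec (Cmod (w a)) (Cmod a)) as [|N]; [assumption|exfalso].
assert (Ha0 : a <> 0).
{ intros E; rewrite E, W0 in N; lra. }
pose proof (proj1 (Cmod_gt_0 a) Ha0) as Pa; specialize (W1 a Ha) as W1a.
set (phi := fun (n : nat) z => (w z * (w z / z) ^ n)%C).
assert (Hphi : forall n, (forall z, in_disc z -> exists l, has_cderiv (phi n) z l)
                         /\ phi n (RtoC 0) = RtoC 0).
{ induction n as [|n [IH I0]]; split; try (unfold phi; rewrite W0, Cmult_0_l; reflexivity).
  - intros z Hz; destruct (Hw z Hz) as [l Hl]; exists l.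
    apply has_cderiv_ext with w; [intros x; unfold phi; simpl; ring|exact Hl].
  - intros z Hz; destruct (IH z Hz) as [l Hl], (Hw z Hz) as [m Hm].
    assert (E : forall x, (phi n x * (w x / x))%C = phi (S n) x)
      by (intros x; unfold phi; simpl; ring).
    destruct (Ceq_dec z 0) as [->|Nz]; eexists; apply (has_cderiv_ext _ _ _ _ E).
    + apply has_cderiv_mult_quotient; eassumption.
    + apply has_cderiv_mult; [exact Hl|].
      apply (has_cderiv_div w (fun x => x)); [exact Nz|exact Hm|apply has_cderiv_id]. }
assert (Hwp : 0 < Cmod (w a)) by lra.
set (q := Cmod (w a) / Cmod a).
assert (Hq : 1 < q) by (apply Rlt_div_r; lra).
(* Midpoint of 1 / q and 1: then q r > 1, and r > |a| because 1 / q > |a|. On |z| = r the function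
   [phi n] is at most r^-n, while at a it equals |w a| q^n in modulus. *)
set (r := (1 + Cmod a / Cmod (w a)) / 2).
assert (Hr1 : Cmod a / Cmod (w a) < 1) by (apply Rlt_div_l; lra).
assert (Hr2 : Cmod a < Cmod a / Cmod (w a)) by (apply Rlt_div_r; nra).
assert (Hr : Cmod a < r < 1) by (unfold r; lra).
assert (Hqr : 1 < q * r).
{ unfold q, r; replace (Cmod (w a) / Cmod a * ((1 + Cmod a / Cmod (w a)) / 2))
    with ((Cmod (w a) / Cmod a + 1) / 2) by (field; lra); fold q; lra. }
destruct (pow_unbounded (q * r) (Cmod (w a)) Hqr Hwp) as [n Hn].
assert (M : Cmod (phi n a) <= / r ^ n).
{ apply (maximum_modulus (phi n) r); [lra|apply Hphi| |lra].
  intros z Hz.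
  assert (Hz1 : in_disc z) by (unfold in_disc; lra).
  specialize (W1 z Hz1); pose proof (Cmod_ge_0 (w z)).
  assert (z <> 0) by (apply Cmod_gt_0; lra).
  unfold phi; rewrite Cmod_mult, Cmod_pow, Cmod_div, Hz by assumption.
  rewrite <- pow_inv, <- (Rmult_1_l ((/ r) ^ n)).
  assert (Cmod (w z) / r <= / r).
  { unfold Rdiv; rewrite <- (Rmult_1_l (/ r)) at 2.
    apply Rmult_le_compat_r; [apply Rlt_le, Rinv_0_lt_compat; lra|lra]. }
  assert (0 <= Cmod (w z) / r) by (apply Rdiv_le_0_compat; lra).
  apply Rmult_le_compat; [lra|apply pow_le; lra|lra|apply pow_incr; lra]. }
unfold phi in M; rewrite Cmod_mult, Cmod_pow, Cmod_div in M by exact Ha0.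
fold q in M; rewrite Rpow_mult_distr in Hn.
assert (Pr : 0 < r ^ n) by (apply pow_lt; lra).
apply Rmult_le_compat_r with (r := r ^ n) in M; [|lra].
rewrite Rinv_l in M by lra; lra.
Qed.

(** * Power series with real coefficients *)

Fixpoint Cpartial (a : nat -> C) (n : nat) : C :=
  match n with
  | O => a O
  | S n => (Cpartial a n + a (S n))%C
  end.

Definition has_csum (a : nat -> C) (l : C) : Prop :=
  forall eps : R, 0 < eps ->
  exists N : nat, forall n : nat, (N <= n)%nat -> Cmod (Cpartial a n - l)%C < eps.

(** A total operator, given its meaning by [Csum_correct] under absolute convergence. *)
Definition Csum (a : nat -> C) : C :=
  (Series (fun n => Re (a n)), Series (fun n => Im (a n))).

Lemma im_le_Cmod (z : C) : Rabs (Im z) <= Cmod z.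
Proof. eapply Rle_trans; [apply Rmax_r|apply Rmax_Cmod]. Qed.

Lemma Cmod_le_re_im (z : C) : Cmod z <= Rabs (Re z) + Rabs (Im z).
Proof.
replace z with (RtoC (Re z) + Ci * RtoC (Im z))%C at 1
  by (destruct z; apply injective_projections; simpl; ring).
eapply Rle_trans; [apply Cmod_triangle|].
rewrite Cmod_mult, Cmod_Ci, !Cmod_R; lra.
Qed.

Lemma Cpartial_re_im (a : nat -> C) (n : nat) :
  Cpartial a n = (sum_n (fun k => Re (a k)) n, sum_n (fun k => Im (a k)) n).
Proof.
induction n as [|n IH].
- rewrite !sum_O; simpl; destruct (a O); reflexivity.
- rewrite !sum_Sn; simpl; rewrite IH; destruct (a (S n)); reflexivity.
Qed.

Lemma Csum_correct (a : nat -> C) :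
  ex_series (fun n => Cmod (a n)) -> has_csum a (Csum a).
Proof.
intros H eps Heps.
assert (HR : ex_series (fun n => Re (a n))).
{ apply (@ex_series_le R_AbsRing R_CompleteNormedModule) with (2 := H).
  intros n; apply re_le_Cmod. }
assert (HI : ex_series (fun n => Im (a n))).
{ apply (@ex_series_le R_AbsRing R_CompleteNormedModule) with (2 := H).
  intros n; apply im_le_Cmod. }
apply Series_correct in HR; apply Series_correct in HI.
destruct (proj1 (is_lim_seq_Reals _ _) HR (eps / 2)) as [N1 H1]; [lra|].
destruct (proj1 (is_lim_seq_Reals _ _) HI (eps / 2)) as [N2 H2]; [lra|].
exists (Nat.max N1 N2); intros n Hn.
specialize (H1 n ltac:(lia)); specialize (H2 n ltac:(lia)); unfold Rdist in H1, H2.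
rewrite Cpartial_re_im; unfold Csum.
eapply Rle_lt_trans; [apply Cmod_le_re_im|].
replace eps with (eps / 2 + eps / 2) by field.
apply Rplus_lt_compat; [exact H1|exact H2].
Qed.

Lemma has_csum_unique (a : nat -> C) (l m : C) :
  has_csum a l -> has_csum a m -> l = m.
Proof.
intros Hl Hm.
assert (E : (l - m)%C = 0).
{ apply Cmod_eq_0; apply Rle_antisym; [|apply Cmod_ge_0].
  apply le_epsilon; intros eps Heps.
  destruct (Hl (eps / 2)) as [N1 H1]; [lra|].
  destruct (Hm (eps / 2)) as [N2 H2]; [lra|].
  specialize (H1 (Nat.max N1 N2) ltac:(lia)); specialize (H2 (Nat.max N1 N2) ltac:(lia)).
  set (s := Cpartial a (Nat.max N1 N2)) in *.
  replace (l - m)%C with ((s - m) - (s - l))%C by ring.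
  eapply Rle_trans; [apply Cmod_minus_le|]; lra. }
replace l with ((l - m) + m)%C by ring; rewrite E; ring.
Qed.

Lemma has_csum_bound (a : nat -> C) (l : C) (B : R) :
  has_csum a l -> (forall n, Cmod (Cpartial a n) <= B) -> Cmod l <= B.
Proof.
intros Hl H; apply le_epsilon; intros eps Heps.
destruct (Hl eps Heps) as [N HN]; specialize (HN N (le_n N)); specialize (H N).
replace l with (Cpartial a N - (Cpartial a N - l))%C by ring.
eapply Rle_trans; [apply Cmod_minus_le|]; lra.
Qed.

Lemma has_csum_ext (a b : nat -> C) (l : C) :
  (forall n, a n = b n) -> has_csum a l -> has_csum b l.
Proof.
intros E H eps Heps; destruct (H eps Heps) as [N HN]; exists N; intros n Hn.
replace (Cpartial b n) with (Cpartial a n); [auto|].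
clear Hn; induction n as [|n IH]; simpl; [apply E|rewrite IH, E; reflexivity].
Qed.

Lemma has_csum_plus (a b : nat -> C) (l m : C) :
  has_csum a l -> has_csum b m -> has_csum (fun n => a n + b n)%C (l + m)%C.
Proof.
intros Hl Hm eps Heps.
destruct (Hl (eps / 2)) as [N1 H1]; [lra|].
destruct (Hm (eps / 2)) as [N2 H2]; [lra|].
exists (Nat.max N1 N2); intros n Hn.
specialize (H1 n ltac:(lia)); specialize (H2 n ltac:(lia)).
assert (E : Cpartial (fun n => a n + b n)%C n = (Cpartial a n + Cpartial b n)%C).
{ clear; induction n as [|n IH]; simpl; [reflexivity|rewrite IH; ring]. }
rewrite E; replace (Cpartial a n + Cpartial b n - (l + m))%C
  with ((Cpartial a n - l) + (Cpartial b n - m))%C by ring.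
eapply Rle_lt_trans; [apply Cmod_triangle|]; lra.
Qed.

Lemma has_csum_scal (c : C) (a : nat -> C) (l : C) :
  has_csum a l -> has_csum (fun n => c * a n)%C (c * l)%C.
Proof.
intros Hl eps Heps; pose proof (Cmod_ge_0 c).
destruct (Hl (eps / (Cmod c + 1))) as [N HN]; [apply Rdiv_lt_0_compat; lra|].
exists N; intros n Hn; specialize (HN n Hn).
assert (E : Cpartial (fun n => c * a n)%C n = (c * Cpartial a n)%C).
{ clear; induction n as [|n IH]; simpl; [reflexivity|rewrite IH; ring]. }
rewrite E; replace (c * Cpartial a n - c * l)%C with (c * (Cpartial a n - l))%C by ring.
rewrite Cmod_mult; apply Rlt_div_r in HN; [|lra].
pose proof (Cmod_ge_0 (Cpartial a n - l)%C); nra.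
Qed.

Lemma has_csum_shift (a : nat -> C) (l : C) :
  has_csum (fun n => a (S n)) l -> has_csum a (a O + l)%C.
Proof.
intros Hl eps Heps; destruct (Hl eps Heps) as [N HN].
exists (S N); intros n Hn; destruct n as [|n]; [lia|].
specialize (HN n ltac:(lia)).
assert (E : Cpartial a (S n) = (a O + Cpartial (fun n => a (S n)) n)%C).
{ clear; induction n as [|n IH]; [reflexivity|].
  change (Cpartial a (S (S n))) with (Cpartial a (S n) + a (S (S n)))%C.
  rewrite IH; simpl; ring. }
rewrite E; replace (a O + Cpartial (fun n => a (S n)) n - (a O + l))%C
  with (Cpartial (fun n => a (S n)) n - l)%C by ring; exact HN.
Qed.

Lemma Cmod_Cpartial_le (a : nat -> C) (n : nat) :
  Cmod (Cpartial a n) <= sum_f_R0 (fun k => Cmod (a k)) n.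
Proof.
induction n as [|n IH]; simpl; [lra|].
eapply Rle_trans; [apply Cmod_triangle|]; lra.
Qed.

(** * Power series on the unit disc and their derivatives *)

Definition cpower_series (c : nat -> R) (z : C) : C :=
  Csum (fun n => RtoC (c n) * z ^ n)%C.

(** Gives convergence on the disc by comparison with a geometric series. The sequences of interest
    satisfy it even after termwise differentiation, which replaces any discussion of radii of
    convergence. *)
Definition bounded_by_1 (c : nat -> R) : Prop := forall n, Rabs (c n) <= 1.

Lemma cpower_series_correct (c : nat -> R) (z : C) :
  bounded_by_1 c -> in_disc z ->
  has_csum (fun n => RtoC (c n) * z ^ n)%C (cpower_series c z).
Proof.
intros Hc Hz; apply Csum_correct.
apply (@ex_series_le R_AbsRing R_CompleteNormedModule) with (fun n => Cmod z ^ n).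
- intros n; unfold norm; simpl; unfold abs; simpl.
  rewrite Rabs_pos_eq by apply Cmod_ge_0.
  rewrite Cmod_mult, Cmod_R, Cmod_pow.
  pose proof (pow_le _ n (Cmod_ge_0 z)); specialize (Hc n); nra.
- apply ex_series_geom; rewrite Rabs_pos_eq by apply Cmod_ge_0; exact Hz.
Qed.

(** Adding up the recurrence gives S(n+1) <= q S(n) + U for the partial sums, and S(n) <= S(n+1).
    This bounds sums such as that of n q^(n-1) without closed forms. *)
Lemma sum_recurrence_bound (m u : nat -> R) (q U : R) :
  q < 1 -> (forall n, 0 <= m n) -> m O = 0 ->
  (forall n, m (S n) <= q * m n + u n) ->
  (forall n, sum_f_R0 u n <= U) ->
  forall n, sum_f_R0 m n <= U / (1 - q).
Proof.
intros Hq Pm M0 H HU n.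
assert (E : forall k, sum_f_R0 m (S k) <= q * sum_f_R0 m k + sum_f_R0 u k).
{ induction k as [|k IH].
  - simpl; specialize (H O); lra.
  - change (sum_f_R0 m (S (S k))) with (sum_f_R0 m (S k) + m (S (S k))).
    change (sum_f_R0 u (S k)) with (sum_f_R0 u k + u (S k)).
    specialize (H (S k)); simpl (sum_f_R0 m (S k)) in *; lra. }
specialize (E n); specialize (HU n); specialize (Pm (S n)); simpl in E.
apply Rle_div_r; lra.
Qed.

Lemma geometric_partial_bound (q : R) (n : nat) :
  0 <= q < 1 -> sum_f_R0 (fun k => q ^ k) n <= 1 / (1 - q).
Proof.
intros Hq; apply Rle_div_r; [lra|].
rewrite tech3 by lra; pose proof (pow_le q (S n)) as P.
replace ((1 - q ^ S n) / (1 - q) * (1 - q)) with (1 - q ^ S n) by (field; lra).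
lra.
Qed.

(** Second-order Taylor remainder of the n-th power; for n = 0 the value [pred 0 = 0] is harmless,
    as the coefficient [INR 0] vanishes. *)
Definition power_remainder (z h : C) (n : nat) : C :=
  ((z + h) ^ n - z ^ n - RtoC (INR n) * z ^ pred n * h)%C.

Lemma power_remainder_S (z h : C) (n : nat) :
  power_remainder z h (S n)
  = ((z + h) * power_remainder z h n + RtoC (INR n) * z ^ pred n * (h * h))%C.
Proof.
unfold power_remainder; rewrite S_INR, RtoC_plus; destruct n as [|n]; simpl; ring.
Qed.

(** Three geometric summations, each costing a factor 1 / (1 - q): the powers q^k, then k |z|^(k-1),
    then the remainders through [power_remainder_S]. The bound is uniform in n, so it survives the
    limit. *)
Lemma power_remainder_sum (z h : C) (q : R) (n : nat) :
  0 <= q < 1 -> Cmod z <= q -> Cmod (z + h)%C <= q ->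
  sum_f_R0 (fun k => Cmod (power_remainder z h k)) n
  <= 1 / (1 - q) / (1 - q) / (1 - q) * Cmod h ^ 2.
Proof.
intros Hq Hz Hzh; pose proof (Cmod_ge_0 z); pose proof (Cmod_ge_0 h).
set (u := fun k => INR k * Cmod z ^ pred k).
assert (Pu : forall k, 0 <= u k)
  by (intros k; apply Rmult_le_pos; [apply pos_INR|apply pow_le; assumption]).
assert (SU : forall n, sum_f_R0 u n <= 1 / (1 - q) / (1 - q)).
{ apply sum_recurrence_bound with (fun k => q ^ k);
    [lra|exact Pu|unfold u; simpl; ring| |intros; apply geometric_partial_bound; lra].
  intros k.
  assert (E : u (S k) = Cmod z * u k + Cmod z ^ k).
  { unfold u; rewrite S_INR; destruct k as [|k]; simpl; ring. }
  rewrite E; apply Rplus_le_compat;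
    [apply Rmult_le_compat_r; auto|apply pow_incr; lra]. }
replace (1 / (1 - q) / (1 - q) / (1 - q) * Cmod h ^ 2)
  with ((1 / (1 - q) / (1 - q) * Cmod h ^ 2) / (1 - q)) by (field; lra).
apply sum_recurrence_bound with (fun k => u k * Cmod h ^ 2).
- lra.
- intros; apply Cmod_ge_0.
- unfold power_remainder; simpl.
  replace (1 - 1 - 0 * 1 * h)%C with (RtoC 0) by ring; apply Cmod_0.
- intros k; rewrite power_remainder_S; eapply Rle_trans; [apply Cmod_triangle|].
  rewrite !Cmod_mult, Cmod_R, Cmod_pow, (Rabs_pos_eq (INR k)) by apply pos_INR.
  apply Rplus_le_compat; [apply Rmult_le_compat_r; [apply Cmod_ge_0|exact Hzh]|].
  right; unfold u; ring.
- intros k; rewrite <- (scal_sum u k (Cmod h ^ 2)), Rmult_comm.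
  apply Rmult_le_compat_r; [nra|apply SU].
Qed.

Definition deriv_coef (c : nat -> R) (n : nat) : R := INR (S n) * c (S n).

Lemma cpower_series_has_cderiv (c : nat -> R) (z : C) :
  bounded_by_1 c -> bounded_by_1 (deriv_coef c) -> in_disc z ->
  has_cderiv (cpower_series c) z (cpower_series (deriv_coef c) z).
Proof.
intros Hc Hd Hz; pose proof (Cmod_ge_0 z); unfold in_disc in Hz.
set (q := (1 + Cmod z) / 2).
apply has_cderiv_square with (1 / (1 - q) / (1 - q) / (1 - q)) ((1 - Cmod z) / 2); [lra|].
intros h Hh.
assert (Hzh : Cmod (z + h)%C <= q)
  by (eapply Rle_trans; [apply Cmod_triangle|]; unfold q; lra).
assert (S0 : has_csum (fun n => RtoC (INR n * c n) * z ^ pred n)%C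
               (cpower_series (deriv_coef c) z)).
{ replace (cpower_series (deriv_coef c) z)
    with (RtoC (INR 0 * c O) * z ^ pred 0 + cpower_series (deriv_coef c) z)%C
    by (simpl; rewrite Rmult_0_l; ring).
  apply (has_csum_shift (fun n => RtoC (INR n * c n) * z ^ pred n)%C).
  apply (cpower_series_correct (deriv_coef c)); assumption. }
pose proof (has_csum_plus _ _ _ _
  (cpower_series_correct c (z + h)%C Hc ltac:(unfold in_disc; unfold q in *; lra))
  (has_csum_plus _ _ _ _
    (has_csum_scal (- (1))%C _ _ (cpower_series_correct c z Hc Hz))
    (has_csum_scal (- h)%C _ _ S0))) as T.
replace (cpower_series c (z + h) - cpower_series c z - cpower_series (deriv_coef c) z * h)%C
  with (cpower_series c (z + h) + (- (1) * cpower_series c z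
          + - h * cpower_series (deriv_coef c) z))%C by ring.
eapply has_csum_bound; [exact T|].
intros n; eapply Rle_trans; [apply Cmod_Cpartial_le|].
eapply Rle_trans; [|apply (power_remainder_sum z h q n); unfold q in *; lra].
apply sum_Rle; intros k _.
replace (RtoC (c k) * (z + h) ^ k
   + (- (1) * (RtoC (c k) * z ^ k) + - h * (RtoC (INR k * c k) * z ^ pred k)))%C
  with (RtoC (c k) * power_remainder z h k)%C
  by (unfold power_remainder; rewrite RtoC_mult; ring).
rewrite Cmod_mult, Cmod_R.
pose proof (Cmod_ge_0 (power_remainder z h k)); specialize (Hc k); nra.
Qed.

Lemma cpower_series_0 (c : nat -> R) :
  bounded_by_1 c -> cpower_series c (RtoC 0) = RtoC (c O).
Proof.
intros Hc; eapply has_csum_unique.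
{ apply cpower_series_correct; [exact Hc|unfold in_disc; rewrite Cmod_0; lra]. }
intros eps Heps; exists O; intros n _.
assert (E : Cpartial (fun n => RtoC (c n) * RtoC 0 ^ n)%C n = RtoC (c O)).
{ induction n as [|n IH]; [simpl; ring|].
  change (Cpartial (fun n => RtoC (c n) * RtoC 0 ^ n)%C n
    + RtoC (c (S n)) * (RtoC 0 * RtoC 0 ^ n) = RtoC (c O))%C.
  rewrite IH, Cmult_0_l; ring. }
rewrite E; unfold Cminus; rewrite Cplus_opp_r, Cmod_0; exact Heps.
Qed.

Lemma cpower_series_real (c : nat -> R) (x : R) :
  cpower_series c (RtoC x) = RtoC (Series (fun n => c n * x ^ n)).
Proof.
unfold cpower_series, Csum; apply injective_projections; simpl.
- apply Series_ext; intros n; rewrite <- RtoC_pow; simpl; ring.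
- transitivity (Series (fun n => 0 * 0)); [|rewrite Series_scal_l; ring].
  apply Series_ext; intros n; rewrite <- RtoC_pow; simpl; ring.
Qed.

(** * The series of the square root *)

Lemma has_csum_near (a : nat -> C) (l m : C) (B : R) :
  has_csum a l -> (forall n, Cmod (Cpartial a n - m)%C <= B) -> Cmod (l - m)%C <= B.
Proof.
intros Hl H; apply le_epsilon; intros eps Heps.
destruct (Hl eps Heps) as [N HN]; specialize (HN N (le_n N)); specialize (H N).
replace (l - m)%C with ((Cpartial a N - m) - (Cpartial a N - l))%C by ring.
eapply Rle_trans; [apply Cmod_minus_le|]; lra.
Qed.

(** The Euler operator z d/dz acts diagonally on coefficients; both differential equations below are
    checked in this form. *)
Lemma cpower_series_euler (c : nat -> R) (z : C) :
  bounded_by_1 (deriv_coef c) -> in_disc z ->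
  has_csum (fun n => RtoC (INR n * c n) * z ^ n)%C
    (z * cpower_series (deriv_coef c) z)%C.
Proof.
intros Hd Hz.
replace (z * cpower_series (deriv_coef c) z)%C
  with (RtoC (INR 0 * c O) * z ^ 0 + z * cpower_series (deriv_coef c) z)%C
  by (simpl; rewrite Rmult_0_l; ring).
apply (has_csum_shift (fun n => RtoC (INR n * c n) * z ^ n)%C).
eapply has_csum_ext; [|apply has_csum_scal, cpower_series_correct; assumption].
intros n; unfold deriv_coef; simpl Cpow; ring.
Qed.

(** The shape shared by [sqrt_coef], [mean_coef] and their rescalings by powers of x in [0, 1]: the
    nonpositive terms never use up the initial 1. It yields convergence at 1, boundedness, and the
    majorant 1 - C(|z|) for |C(z) - 1|, where C is the power series. *)
Definition unit_drop (c : nat -> R) : Prop :=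
  c O = 1 /\ (forall n, c (S n) <= 0) /\ (forall n, 0 <= sum_f_R0 c n).

Lemma unit_drop_decr (c : nat -> R) (n : nat) :
  unit_drop c -> sum_f_R0 c (S n) <= sum_f_R0 c n.
Proof. intros (_ & H & _); simpl; specialize (H n); lra. Qed.

Lemma unit_drop_is_series (c : nat -> R) :
  unit_drop c -> ex_series c /\ is_lim_seq (sum_f_R0 c) (Series c).
Proof.
intros H.
assert (E : ex_finite_lim_seq (sum_f_R0 c)).
{ apply ex_finite_lim_seq_decr with 0; [intros; apply unit_drop_decr, H|apply H]. }
destruct E as [l Hl].
assert (X : is_series c l).
{ change (is_lim_seq (sum_n c) l); apply is_lim_seq_ext with (sum_f_R0 c); [intros; symmetry; apply sum_n_Reals|exact Hl]. }
split; [exists l; exact X|rewrite (is_series_unique _ _ X); exact Hl].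
Qed.

Lemma unit_drop_Series_le (c : nat -> R) (n : nat) :
  unit_drop c -> Series c <= sum_f_R0 c n.
Proof.
intros H; apply (is_lim_seq_decr_compare (sum_f_R0 c));
  [apply unit_drop_is_series, H|intros; apply unit_drop_decr, H].
Qed.

Lemma pow_le_1 (x : R) (n : nat) : 0 <= x <= 1 -> 0 <= x ^ n <= 1.
Proof.
intros Hx; split; [apply pow_le; lra|].
rewrite <- (pow1 n); apply pow_incr; exact Hx.
Qed.

Lemma unit_drop_le (c d : nat -> R) :
  unit_drop c -> d O = 1 -> (forall n, c (S n) <= d (S n) <= 0) -> unit_drop d.
Proof.
intros (C0 & _ & C2) D0 D1; repeat split; [exact D0|apply D1|].
intros n; apply Rle_trans with (sum_f_R0 c n); [apply C2|].
apply sum_Rle; intros [|k] _; [lra|apply D1].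
Qed.

Lemma unit_drop_scaled (c : nat -> R) (x : R) :
  unit_drop c -> 0 <= x <= 1 -> unit_drop (fun n => c n * x ^ n).
Proof.
intros H Hx; apply unit_drop_le with c; [exact H|destruct H as [-> _]; simpl; ring|].
intros n; destruct H as (_ & H & _); specialize (H n).
pose proof (pow_le_1 x (S n) Hx); nra.
Qed.

Lemma unit_drop_bounded (c : nat -> R) : unit_drop c -> bounded_by_1 c.
Proof.
intros (C0 & C1 & C2) [|n]; [rewrite C0, Rabs_R1; lra|].
rewrite Rabs_left1 by apply C1.
assert (sum_f_R0 c n <= 1).
{ induction n as [|n IH]; simpl; [lra|specialize (C1 n); lra]. }
specialize (C2 (S n)); simpl in C2; lra.
Qed.

(** The left side is the sum of |c n| x^n over n >= 1, and x^n <= x there. The factor x is the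
    source of strict inequalities inside the disc. *)
Lemma unit_drop_linear_bound (c : nat -> R) (x : R) :
  unit_drop c -> 0 <= x <= 1 ->
  1 - Series (fun n => c n * x ^ n) <= x * (1 - Series c).
Proof.
intros H Hx.
pose proof (proj2 (unit_drop_is_series _ (unit_drop_scaled c x H Hx))) as L1.
pose proof (proj2 (unit_drop_is_series _ H)) as L2.
assert (I : forall n, x * sum_f_R0 c n + (1 - x) <= sum_f_R0 (fun n => c n * x ^ n) n).
{ destruct H as (C0 & C1 & _); induction n as [|n IH]; simpl; [rewrite C0; lra|].
  pose proof (pow_le_1 x n Hx); specialize (C1 n).
  assert (c (S n) * (1 - x ^ n) <= 0) by nra.
  assert (x * (c (S n) * (1 - x ^ n)) <= 0) by nra; nra. }
pose proof (is_lim_seq_le _ _ _ _ I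
  (is_lim_seq_plus' _ _ _ _ (is_lim_seq_scal_l _ x _ L2) (is_lim_seq_const (1 - x))) L1) as T.
simpl in T; lra.
Qed.

Lemma unit_drop_cpower_series (c : nat -> R) (z : C) (x : R) :
  unit_drop c -> Cmod z <= x -> x < 1 ->
  Cmod (cpower_series c z - 1)%C <= 1 - Series (fun n => c n * x ^ n).
Proof.
intros H Hz Hx; pose proof (Cmod_ge_0 z).
pose proof (unit_drop_scaled c x H ltac:(lra)) as Hs.
eapply has_csum_near;
  [apply cpower_series_correct; [apply unit_drop_bounded, H|unfold in_disc; lra]|].
intros n; apply Rle_trans with (1 - sum_f_R0 (fun n => c n * x ^ n) n);
  [|pose proof (unit_drop_Series_le _ n Hs); lra].
destruct H as (C0 & C1 & _); induction n as [|n IH].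
- simpl; rewrite C0; replace (RtoC 1 * 1 - 1)%C with (RtoC 0) by ring; rewrite Cmod_0; lra.
- change (Cpartial (fun n => RtoC (c n) * z ^ n)%C (S n))
    with (Cpartial (fun n => RtoC (c n) * z ^ n)%C n + RtoC (c (S n)) * z ^ S n)%C.
  change (sum_f_R0 (fun n => c n * x ^ n) (S n))
    with (sum_f_R0 (fun n => c n * x ^ n) n + c (S n) * x ^ S n).
  set (s := Cpartial _ n) in *.
  replace (s + RtoC (c (S n)) * z ^ S n - 1)%C
    with ((s - 1) + RtoC (c (S n)) * z ^ S n)%C by ring.
  eapply Rle_trans; [apply Cmod_triangle|].
  rewrite Cmod_mult, Cmod_R, Cmod_pow, Rabs_left1 by apply C1.
  specialize (C1 n).
  assert (Cmod z ^ S n <= x ^ S n) by (apply pow_incr; lra).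
  assert (0 <= Cmod z ^ S n) by (apply pow_le; lra); nra.
Qed.

(* [(-1/2)_j / j!], the coefficients of [sqrt (1 - z)]. *)
Fixpoint sqrt_coef (j : nat) : R :=
  match j with
  | O => 1
  | S j => sqrt_coef j * (INR j - 1 / 2) / INR (S j)
  end.

Lemma sqrt_coef_S (j : nat) :
  INR (S j) * sqrt_coef (S j) = sqrt_coef j * (INR j - 1 / 2).
Proof.
change (sqrt_coef (S j)) with (sqrt_coef j * (INR j - 1 / 2) / INR (S j)).
field; apply not_0_INR; discriminate.
Qed.

Lemma sqrt_coef_neg (j : nat) : sqrt_coef (S j) < 0.
Proof.
induction j as [|j IH]; [simpl; lra|].
pose proof (sqrt_coef_S (S j)) as E; rewrite !S_INR in E.
pose proof (pos_INR j); nra.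
Qed.

(** Generating functions: sqrt (1 - z) / (1 - z) = -2 d/dz sqrt (1 - z). This one identity gives
    both the nonnegativity of partial sums and the bound on n times the n-th coefficient. *)
Lemma sqrt_coef_sum (n : nat) :
  sum_f_R0 sqrt_coef n = - 2 * (INR (S n) * sqrt_coef (S n)).
Proof.
induction n as [|n IH]; [simpl; lra|].
change (sum_f_R0 sqrt_coef (S n)) with (sum_f_R0 sqrt_coef n + sqrt_coef (S n)).
rewrite IH, (sqrt_coef_S (S n)), !S_INR; field.
Qed.

Lemma sqrt_coef_unit_drop : unit_drop sqrt_coef.
Proof.
split; [reflexivity|split; intros n; [apply Rlt_le, sqrt_coef_neg|]].
rewrite sqrt_coef_sum; pose proof (sqrt_coef_neg n); pose proof (pos_INR (S n)); nra.
Qed.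

Lemma sqrt_coef_deriv_bounded : bounded_by_1 (deriv_coef sqrt_coef).
Proof.
intros n; unfold deriv_coef.
pose proof (sqrt_coef_sum n) as E.
assert (H : sum_f_R0 sqrt_coef n <= 1).
{ destruct sqrt_coef_unit_drop as (_ & C1 & _).
  clear E; induction n as [|n IH]; simpl; [lra|specialize (C1 n); simpl in C1; lra]. }
pose proof (proj2 (proj2 sqrt_coef_unit_drop) n); apply Rabs_le; lra.
Qed.

(* The coefficients of the integral over [0 <= t <= 1] of [sqrt (1 - z t^beta)]. *)
Definition mean_coef (beta : R) (j : nat) : R := sqrt_coef j / (1 + INR j * beta).

Lemma mean_coef_denominator (beta : R) (j : nat) :
  0 < beta -> 1 <= 1 + INR j * beta.
Proof. intros H; pose proof (pos_INR j); nra. Qed.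

Lemma mean_coef_between (beta : R) (j : nat) :
  0 < beta -> sqrt_coef (S j) <= mean_coef beta (S j) <= 0.
Proof.
intros H; unfold mean_coef; pose proof (sqrt_coef_neg j) as N.
pose proof (mean_coef_denominator beta (S j) H) as D.
set (d := 1 + INR (S j) * beta) in *; set (s := sqrt_coef (S j)) in *; clearbody d s.
split; [apply Rle_div_r|apply Rle_div_l]; nra.
Qed.

Lemma mean_coef_unit_drop (beta : R) : 0 < beta -> unit_drop (mean_coef beta).
Proof.
intros H; apply unit_drop_le with sqrt_coef;
  [apply sqrt_coef_unit_drop|unfold mean_coef; simpl; field; lra|].
intros n; apply mean_coef_between, H.
Qed.

Lemma mean_coef_deriv_bounded (beta : R) :
  0 < beta -> bounded_by_1 (deriv_coef (mean_coef beta)).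
Proof.
intros H n; pose proof (sqrt_coef_deriv_bounded n) as B; revert B; unfold deriv_coef.
pose proof (mean_coef_between beta n H); pose proof (pos_INR (S n)).
intros B; apply Rabs_le_between in B; apply Rabs_le; nra.
Qed.

Lemma mean_coef_ode (beta : R) (z : C) :
  0 < beta -> in_disc z ->
  (cpower_series (mean_coef beta) z
   + RtoC beta * z * cpower_series (deriv_coef (mean_coef beta)) z)%C
  = cpower_series sqrt_coef z.
Proof.
intros Hb Hz; eapply has_csum_unique;
  [|apply cpower_series_correct; [apply unit_drop_bounded, sqrt_coef_unit_drop|exact Hz]].
rewrite <- Cmult_assoc.
eapply has_csum_ext; [|apply has_csum_plus;
  [apply cpower_series_correct; [apply unit_drop_bounded, mean_coef_unit_drop, Hb|exact Hz]
  |apply has_csum_scal, cpower_series_euler; [apply mean_coef_deriv_bounded, Hb|exact Hz]]].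
intros n; simpl; unfold mean_coef.
pose proof (mean_coef_denominator beta n Hb).
replace (sqrt_coef n)
  with (sqrt_coef n / (1 + INR n * beta) + beta * (INR n * (sqrt_coef n / (1 + INR n * beta))))
  at 3 by (field; lra).
rewrite RtoC_plus, (RtoC_mult beta); ring.
Qed.

(** The recurrence (n + 1) a_(n+1) = (n - 1/2) a_n, read on the series as 2 (1 - z) A' = - A. *)
Lemma sqrt_series_ode (z : C) :
  in_disc z ->
  (RtoC 2 * (1 - z) * cpower_series (deriv_coef sqrt_coef) z)%C
  = (- cpower_series sqrt_coef z)%C.
Proof.
intros Hz; pose proof (cpower_series_correct (deriv_coef sqrt_coef) z
  sqrt_coef_deriv_bounded Hz) as H1.
pose proof (cpower_series_euler sqrt_coef z sqrt_coef_deriv_bounded Hz) as H2.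
pose proof (cpower_series_correct sqrt_coef z
  (unit_drop_bounded _ sqrt_coef_unit_drop) Hz) as H3.
apply has_csum_unique with (fun n => - (1) * (RtoC (sqrt_coef n) * z ^ n))%C.
2:{ replace (- cpower_series sqrt_coef z)%C with (- (1) * cpower_series sqrt_coef z)%C by ring.
    apply has_csum_scal, H3. }
replace (RtoC 2 * (1 - z) * cpower_series (deriv_coef sqrt_coef) z)%C
  with (RtoC 2 * cpower_series (deriv_coef sqrt_coef) z
    + - RtoC 2 * (z * cpower_series (deriv_coef sqrt_coef) z))%C by ring.
eapply has_csum_ext; [|apply has_csum_plus; apply has_csum_scal; [exact H1|exact H2]].
intros n; cbv beta; unfold deriv_coef; rewrite sqrt_coef_S.
replace (sqrt_coef n * (INR n - 1 / 2)) with (INR n * sqrt_coef n + - (1 / 2) * sqrt_coef n) by ring.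
rewrite RtoC_plus, (RtoC_mult (- (1 / 2))).
replace (RtoC (- (1 / 2))) with (- / RtoC 2)%C
  by (rewrite <- RtoC_inv, <- RtoC_opp by lra; apply (f_equal RtoC); field).
field; apply RtoC_neq; lra.
Qed.

(** * Identification of the series with the branch [phi_L] *)

Lemma is_derive_zero_const (f : R -> R) (a b : R) :
  a <= b -> (forall t, a <= t <= b -> is_derive f t 0) -> f a = f b.
Proof.
intros Hab H.
destruct (MVT_gen f a b (fun _ => 0)) as [c [_ Hc]].
- intros x; rewrite Rmin_left, Rmax_right by lra; intros Hx; apply H; lra.
- intros x; rewrite Rmin_left, Rmax_right by lra; intros Hx.
  apply continuity_pt_filterlim, (ex_derive_continuous f); exists 0; apply H; lra.
- lra.
Qed.

Lemma in_disc_ray (t : R) (z : C) : 0 <= t <= 1 -> in_disc z -> in_disc (RtoC t * z)%C.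
Proof.
unfold in_disc; intros Ht Hz; rewrite Cmod_mult, Cmod_R, Rabs_pos_eq by lra.
pose proof (Cmod_ge_0 z); nra.
Qed.

(** The real mean value theorem on the segment from 0 to z, applied to Re (c g) with c = 1 and c = i
    to recover both coordinates. *)
Lemma has_cderiv_zero_const (g : C -> C) (z : C) :
  (forall x, in_disc x -> has_cderiv g x 0) -> in_disc z -> g z = g (RtoC 0).
Proof.
intros H Hz.
assert (K : forall c : C, Re (c * g (RtoC 0))%C = Re (c * g z)%C).
{ intros c.
  pose proof (is_derive_zero_const (fun s : R => Re (c * g (RtoC s * z)%C)%C) 0 1) as E.
  simpl in E; rewrite Cmult_0_l, Cmult_1_l in E; apply E; [lra|].
  intros t Ht; replace 0 with (Re (c * (0 * z))%C)
    by (destruct c, z; simpl; ring).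
  apply has_cderiv_ray, H, in_disc_ray; assumption. }
pose proof (K (RtoC 1)) as K1; pose proof (K Ci) as K2.
destruct (g z), (g (RtoC 0)); simpl in K1, K2.
apply injective_projections; simpl; lra.
Qed.

Lemma Cone_minus_neq_0 (z : C) : in_disc z -> (1 - z)%C <> 0.
Proof.
intros Hz E; unfold in_disc in Hz.
replace z with (RtoC 1) in Hz; [rewrite Cmod_1 in Hz; lra|].
replace (RtoC 1) with ((1 - z) + z)%C by ring; rewrite E; ring.
Qed.

(** By the differential equation A^2 / (1 - z) has derivative 0, and it is 1 at the origin. *)
Lemma sqrt_series_sqr (z : C) :
  in_disc z -> (cpower_series sqrt_coef z * cpower_series sqrt_coef z)%C = (1 - z)%C.
Proof.
intros Hz; set (A := cpower_series sqrt_coef).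
pose proof (unit_drop_bounded _ sqrt_coef_unit_drop) as Hb.
assert (E : (A z * A z / (1 - z))%C = (A (RtoC 0) * A (RtoC 0) / (1 - 0))%C).
{ apply (has_cderiv_zero_const (fun z => A z * A z / (1 - z))%C); [|exact Hz].
  intros x Hx; pose proof (Cone_minus_neq_0 x Hx) as N.
  pose proof (cpower_series_has_cderiv sqrt_coef x Hb sqrt_coef_deriv_bounded Hx) as D.
  pose proof (sqrt_series_ode x Hx) as O; fold A in D, O.
  set (A' := cpower_series (deriv_coef sqrt_coef) x) in *.
  replace (RtoC 0) with
    (((A' * A x + A x * A') * (1 - x) - (A x * A x) * (0 + - (1) * 1)) / ((1 - x) * (1 - x)))%C.
  - apply (has_cderiv_div (fun z => A z * A z)%C (fun z => 1 - z)%C); [exact N| |].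
    + apply has_cderiv_mult; exact D.
    + apply has_cderiv_ext with (fun z => 1 + - (1) * z)%C; [intros; ring|].
      apply has_cderiv_plus; [apply has_cderiv_const|apply has_cderiv_scal, has_cderiv_id].
  - replace ((A' * A x + A x * A') * (1 - x) - (A x * A x) * (0 + - (1) * 1))%C
      with (A x * (RtoC 2 * (1 - x) * A' + A x))%C by (replace (RtoC 2) with (1 + 1)%C by (rewrite <- RtoC_plus; apply (f_equal RtoC); ring); ring).
    rewrite O; field; exact N. }
pose proof (Cone_minus_neq_0 z Hz) as N.
unfold A in E at 3 4; rewrite cpower_series_0 in E by exact Hb; simpl sqrt_coef in E.
replace (A z * A z)%C with ((A z * A z / (1 - z)) * (1 - z))%C by (field; exact N).
rewrite E; field; replace (1 - 0)%C with (RtoC 1) by ring; apply RtoC_neq; lra.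
Qed.

(** Both sides square to 1 - z and have positive real part, so their sum cannot vanish. For A this
    follows from |A - 1| <= 1 - A(|z|) <= |z| (1 - A(1)) <= |z| < 1. *)
Lemma phi_L_series (z : C) : in_disc z -> phi_L (- z)%C = cpower_series sqrt_coef z.
Proof.
intros Hz; set (A := cpower_series sqrt_coef z).
assert (Hz' : in_disc (- z)%C) by (unfold in_disc; rewrite Cmod_opp; exact Hz).
assert (RA : 0 < Re A).
{ unfold in_disc in Hz; pose proof (Cmod_ge_0 z).
  pose proof (unit_drop_cpower_series sqrt_coef z (Cmod z) sqrt_coef_unit_drop
    (Rle_refl _) Hz) as B1.
  pose proof (unit_drop_linear_bound sqrt_coef (Cmod z) sqrt_coef_unit_drop ltac:(lra)) as B2.
  assert (B3 : 0 <= Series sqrt_coef).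
  { pose proof (is_lim_seq_le (fun _ => 0) _ _ _ (proj2 (proj2 sqrt_coef_unit_drop))
      (is_lim_seq_const 0) (proj2 (unit_drop_is_series _ sqrt_coef_unit_drop))) as T.
    exact T. }
  fold A in B1; pose proof (re_le_Cmod (A - 1)%C) as B4; apply Rabs_le_between in B4.
  assert (Re (A - 1)%C = Re A - 1) by (destruct A; reflexivity).
  nra. }
pose proof (phi_L_Re_gt0 _ Hz') as RP; pose proof (phi_L_sqr (- z)%C) as SP.
pose proof (sqrt_series_sqr z Hz) as SA; fold A in SA.
set (P := phi_L (- z)%C) in *.
assert (N : (P + A)%C <> 0).
{ intros E; assert (Re (P + A)%C = 0) by (rewrite E; reflexivity).
  destruct P, A; simpl in *; lra. }
assert (F : ((P - A) * (P + A) = 0)%C).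
{ replace ((P - A) * (P + A))%C with (P * P - A * A)%C by ring.
  rewrite SP, SA; ring. }
destruct (Ceq_dec (P - A) 0) as [Z|Z].
- replace P with ((P - A) + A)%C by ring; rewrite Z; ring.
- contradiction (Cmult_neq_0 _ _ Z N F).
Qed.

(** * The equation for beta_L *)

Lemma mean_coef_lim (beta : R) :
  0 < beta -> is_lim_seq (sum_f_R0 (mean_coef beta)) (Series (mean_coef beta)).
Proof. intros H; apply unit_drop_is_series, mean_coef_unit_drop, H. Qed.

Lemma mean_coef_mono (b b' : R) (n : nat) :
  0 < b <= b' -> mean_coef b n <= mean_coef b' n.
Proof.
intros H; destruct n as [|n]; [right; unfold mean_coef; simpl; field; lra|].
unfold mean_coef, Rdiv; pose proof (sqrt_coef_neg n).
pose proof (mean_coef_denominator b (S n) ltac:(lra)).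
apply Rmult_le_compat_neg_l; [lra|]; apply Rinv_le_contravar; [lra|].
pose proof (pos_INR (S n)); nra.
Qed.

(** Every term is monotone in beta; carrying the gap d of the term of index 1 along the partial sums
    keeps the inequality strict in the limit. *)
Lemma mean_coef_Series_increasing (b b' : R) :
  0 < b < b' -> Series (mean_coef b) < Series (mean_coef b').
Proof.
intros H; set (d := mean_coef b' 1 - mean_coef b 1).
assert (Hd : 0 < d).
{ unfold d, mean_coef; simpl.
  assert (/ (1 + 1 * b') < / (1 + 1 * b)) by (apply Rinv_lt_contravar; nra).
  unfold Rdiv; nra. }
assert (I : forall n, sum_f_R0 (mean_coef b) (S n) + d <= sum_f_R0 (mean_coef b') (S n)).
{ induction n as [|n IH].
  - simpl; unfold d; pose proof (mean_coef_mono b b' 0 ltac:(lra)); lra.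
  - pose proof (mean_coef_mono b b' (S (S n)) ltac:(lra)).
    rewrite (tech5 _ (S n)), (tech5 (mean_coef b') (S n)); lra. }
pose proof (is_lim_seq_le _ _ _ _ I
  (is_lim_seq_plus' _ _ _ _
     (proj1 (is_lim_seq_incr_1 _ _) (mean_coef_lim b ltac:(lra))) (is_lim_seq_const d))
  (proj1 (is_lim_seq_incr_1 _ _) (mean_coef_lim b' ltac:(lra)))) as T.
simpl in T; lra.
Qed.

(** Termwise, n / ((1 + n b)(1 + n b')) <= 1 / m, and the absolute values of [sqrt_coef] sum to at
    most 2. *)
Lemma mean_coef_Series_lipschitz (m b b' : R) :
  0 < m -> m <= b -> m <= b' ->
  Series (mean_coef b) - Series (mean_coef b') <= 2 * (Rabs (b - b') / m).
Proof.
intros Hm Hb Hb'; set (d := Rabs (b - b') / m).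
assert (Hd : 0 <= d) by (apply Rdiv_le_0_compat; [apply Rabs_pos|lra]).
assert (P : forall n, mean_coef b n - mean_coef b' n <= d * Rabs (sqrt_coef n)).
{ intros n; eapply Rle_trans; [apply Rle_abs|]; unfold mean_coef.
  pose proof (mean_coef_denominator b n ltac:(lra)) as D.
  pose proof (mean_coef_denominator b' n ltac:(lra)) as D'.
  replace (sqrt_coef n / (1 + INR n * b) - sqrt_coef n / (1 + INR n * b'))
    with (- (b - b') * (INR n / ((1 + INR n * b) * (1 + INR n * b'))) * sqrt_coef n)
    by (field; lra).
  rewrite !Rabs_mult, Rabs_Ropp; apply Rmult_le_compat_r; [apply Rabs_pos|].
  apply Rmult_le_compat_l; [apply Rabs_pos|].
  pose proof (pos_INR n).
  rewrite Rabs_pos_eq by (apply Rdiv_le_0_compat; nra).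
  apply Rle_div_l; [nra|].
  apply Rmult_le_reg_l with m; [exact Hm|].
  rewrite <- Rmult_assoc, Rinv_r, Rmult_1_l by lra; nra. }
assert (A2 : forall n, sum_f_R0 (fun k => Rabs (sqrt_coef k)) n = 2 - sum_f_R0 sqrt_coef n).
{ induction n as [|n IH]; [simpl; rewrite Rabs_R1; lra|].
  rewrite !tech5, IH, Rabs_left by apply sqrt_coef_neg; lra. }
assert (I : forall n, sum_f_R0 (mean_coef b) n <= sum_f_R0 (mean_coef b') n + 2 * d).
{ intros n.
  assert (sum_f_R0 (fun k => mean_coef b k - mean_coef b' k) n
          <= sum_f_R0 (fun k => Rabs (sqrt_coef k) * d) n)
    by (apply sum_Rle; intros k _; rewrite Rmult_comm; apply P).
  rewrite minus_sum, <- scal_sum, A2 in H.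
  pose proof (proj2 (proj2 sqrt_coef_unit_drop) n); nra. }
pose proof (is_lim_seq_le _ _ _ _ I (mean_coef_lim b ltac:(lra))
  (is_lim_seq_plus' _ _ _ _ (mean_coef_lim b' ltac:(lra)) (is_lim_seq_const (2 * d)))) as T.
simpl in T; lra.
Qed.

Lemma mean_coef_Series_continuous (b : R) :
  0 < b -> continuity_pt (fun b => Series (mean_coef b)) b.
Proof.
intros Hb eps Heps.
exists (Rmin (b / 2) (eps * b / 8)); split.
{ apply Rmin_glb_lt; [lra|]; apply Rdiv_lt_0_compat; nra. }
intros x [_ Hx]; simpl in *; unfold Rdist in *.
pose proof (Rlt_le_trans _ _ _ Hx (Rmin_l _ _)) as H1.
pose proof (Rlt_le_trans _ _ _ Hx (Rmin_r _ _)) as H2.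
apply Rabs_def2 in H1.
pose proof (mean_coef_Series_lipschitz (b / 2) x b ltac:(lra) ltac:(lra) ltac:(lra)) as L1.
pose proof (mean_coef_Series_lipschitz (b / 2) b x ltac:(lra) ltac:(lra) ltac:(lra)) as L2.
rewrite (Rabs_minus_sym b x) in L2.
assert (0 < eps * b) by nra.
assert (Rabs (x - b) / (b / 2) < eps / 2) by (apply Rlt_div_l; lra).
apply Rabs_def1; lra.
Qed.

Lemma mean_coef_root : exists b, 0 < b /\ Series (mean_coef b) = 1 / 3.
Proof.
destruct (IVT_interv (fun b => Series (mean_coef b) - 1 / 3) (1 / 100) 1) as [b [Hb E]].
- intros x Hx; apply continuity_pt_minus; [apply mean_coef_Series_continuous; lra|].
  apply continuity_pt_const; intros ? ?; reflexivity.
- lra.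
(* At beta = 1/100 the partial sum through index 3, about 0.322, is already below 1/3, and it bounds
   the series from above. *)
- pose proof (unit_drop_Series_le _ 3 (mean_coef_unit_drop (1 / 100) ltac:(lra))) as H.
  unfold mean_coef in H at 2; simpl in H; lra.
(* At beta = 1 each negative term is divided by n + 1 >= 2, which leaves a sum of at least 1/2. *)
- assert (I : forall n, 1 / 2 + 1 / 2 * sum_f_R0 sqrt_coef n <= sum_f_R0 (mean_coef 1) n).
  { induction n as [|n IH]; [unfold mean_coef; simpl; lra|].
    rewrite !tech5.
    assert (1 / 2 * sqrt_coef (S n) <= mean_coef 1 (S n)); [|lra].
    unfold mean_coef; pose proof (sqrt_coef_neg n); pose proof (pos_INR n).
    assert (sqrt_coef (S n) * INR n <= 0) by nra.
    rewrite S_INR; refine (proj1 (Rle_div_r _ _ _ _) _); lra. }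
  assert (J : forall n, 1 / 2 <= sum_f_R0 (mean_coef 1) n).
  { intros n; specialize (I n); pose proof (proj2 (proj2 sqrt_coef_unit_drop) n); lra. }
  pose proof (is_lim_seq_le _ _ _ _ J (is_lim_seq_const (1 / 2))
    (mean_coef_lim 1 ltac:(lra))) as T.
  simpl in T; lra.
- exists b; lra.
Qed.

(** * The Gamma function at -1/2 + j and the equation for beta *)

Definition gamma_seq (x : R) (n : nat) : R :=
  INR (fact n) * Rpower (INR n) x / prod_f_R0 (fun k => x + INR k) n.

Lemma prod_shift (x : R) (n : nat) :
  prod_f_R0 (fun k => x + 1 + INR k) n * x
  = prod_f_R0 (fun k => x + INR k) n * (x + INR n + 1).
Proof.
induction n as [|n IH]; [simpl; ring|].
change (prod_f_R0 (fun k => x + 1 + INR k) n * (x + 1 + INR (S n)) * x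
  = prod_f_R0 (fun k => x + INR k) n * (x + INR (S n)) * (x + INR (S n) + 1)).
replace (prod_f_R0 (fun k => x + 1 + INR k) n * (x + 1 + INR (S n)) * x)
  with (prod_f_R0 (fun k => x + 1 + INR k) n * x * (x + 1 + INR (S n))) by ring.
rewrite IH, S_INR; ring.
Qed.

Lemma prod_neq_0 (f : nat -> R) (n : nat) :
  (forall k, f k <> 0) -> prod_f_R0 f n <> 0.
Proof.
intros H; induction n as [|n IH]; simpl; [apply H|].
apply Rmult_integral_contrapositive_currified; auto.
Qed.

(** The functional equation Gamma(x + 1) = x Gamma(x) before the limit: the two sequences differ by
    the factor x n / (n + x + 1), which tends to x. *)
Lemma gamma_seq_shift (x L : R) :
  (forall k, x + INR k <> 0) ->
  is_lim_seq (gamma_seq x) L -> is_lim_seq (gamma_seq (x + 1)) (x * L).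
Proof.
intros Hx HL.
assert (R1 : is_lim_seq (fun n => x * (1 - (x + 1) * / (INR n + (x + 1)))) (x * (1 - (x + 1) * 0))).
{ apply (is_lim_seq_scal_l _ x (1 - (x + 1) * 0)).
  apply is_lim_seq_minus'; [apply is_lim_seq_const|].
  apply (is_lim_seq_scal_l _ (x + 1) 0).
  apply (is_lim_seq_inv (fun n => INR n + (x + 1)) p_infty); [|discriminate].
  eapply is_lim_seq_plus; [apply is_lim_seq_INR|apply is_lim_seq_const|reflexivity]. }
pose proof (is_lim_seq_mult' _ _ _ _ R1 HL) as T.
replace (x * (1 - (x + 1) * 0) * L) with (x * L) in T by ring.
(* Index 0 is dropped because [Rpower_1] asks for a positive base. *)
apply is_lim_seq_incr_1 in T; apply is_lim_seq_incr_1.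
eapply is_lim_seq_ext; [|exact T].
intros n; cbv beta; unfold gamma_seq.
pose proof (prod_shift x (S n)) as E.
pose proof (prod_neq_0 (fun k => x + INR k) (S n) Hx) as N1.
assert (N2 : x + INR (S n) + 1 <> 0).
{ pose proof (Hx (S (S n))) as N; rewrite S_INR in N; lra. }
assert (N0 : x <> 0) by (pose proof (Hx O) as N; simpl in N; lra).
assert (N3 : prod_f_R0 (fun k => x + 1 + INR k) (S n) <> 0).
{ apply prod_neq_0; intros k N; apply (Hx (S k)); rewrite S_INR; lra. }
assert (P : 0 < INR (S n)) by (apply lt_0_INR; lia).
rewrite Rpower_plus, Rpower_1 by exact P.
set (p := prod_f_R0 (fun k => x + INR k) (S n)) in *.
set (q := prod_f_R0 (fun k => x + 1 + INR k) (S n)) in *.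
replace q with (p * (x + INR (S n) + 1) / x)
  by (rewrite <- E; field; exact N0).
set (i := INR (S n)) in *; clearbody i p.
field; repeat split; try assumption; lra.
Qed.

Lemma half_pole_free (k : nat) : - (1 / 2) + INR k <> 0.
Proof.
intros E; assert (H : INR (2 * k) = INR 1) by (rewrite mult_INR; simpl; lra).
apply INR_eq in H; lia.
Qed.

(* Squares of the negative numbers [gamma_seq (-1/2) n]; the square decreases
   while its product with [n / (n + 1)] increases. *)
Definition gamma_square (n : nat) : R :=
  INR (fact n) ^ 2 / (INR n * prod_f_R0 (fun k => - (1 / 2) + INR k) n ^ 2).

Lemma half_prod_neg (n : nat) : prod_f_R0 (fun k => - (1 / 2) + INR k) n < 0.
Proof.
induction n as [|n IH]; [simpl; lra|].
change (prod_f_R0 (fun k => - (1 / 2) + INR k) n * (- (1 / 2) + INR (S n)) < 0).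
rewrite S_INR; pose proof (pos_INR n); nra.
Qed.

Lemma gamma_seq_half (n : nat) :
  gamma_seq (- (1 / 2)) (S n) = - sqrt (gamma_square (S n)).
Proof.
assert (P : 0 < INR (S n)) by (apply lt_0_INR; lia).
pose proof (half_prod_neg (S n)) as N; pose proof (INR_fact_lt_0 (S n)) as F.
pose proof (sqrt_lt_R0 _ P) as Ps; pose proof (sqrt_sqrt _ (Rlt_le _ _ P)) as Es.
unfold gamma_seq, gamma_square.
rewrite Rpower_Ropp; replace (1 / 2) with (/ 2) at 1 by field; rewrite Rpower_sqrt by exact P.
set (p := prod_f_R0 _ (S n)) in *; set (s := sqrt (INR (S n))) in *; rewrite <- Es.
set (t := INR (fact (S n))) in *.
replace (t ^ 2 / (s * s * p ^ 2)) with ((t / (s * - p)) * (t / (s * - p))) by (field; lra).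
rewrite sqrt_square by (apply Rlt_le, Rdiv_lt_0_compat; nra); field; lra.
Qed.

Lemma gamma_square_step (n : nat) :
  gamma_square (S (S n))
  = gamma_square (S n) * (INR (S n) * (INR (S n) + 1) / (INR (S n) + 1 / 2) ^ 2).
Proof.
assert (P : 0 < INR (S n)) by (apply lt_0_INR; lia).
pose proof (half_prod_neg (S n)) as N.
unfold gamma_square.
change (prod_f_R0 (fun k => - (1 / 2) + INR k) (S (S n)))
  with (prod_f_R0 (fun k => - (1 / 2) + INR k) (S n) * (- (1 / 2) + INR (S (S n)))).
rewrite fact_simpl, mult_INR, (S_INR (S n)).
set (p := prod_f_R0 _ (S n)) in *; set (i := INR (S n)) in *; set (t := INR (fact (S n))).
clearbody p i t; field; lra.
Qed.

(** The limit L, which is Gamma(-1/2), must exist and be nonzero for it to cancel in the equation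
    for beta. The decreasing squares give existence; the increasing products, with n / (n + 1) <= 1,
    keep the squares above half of the first one. *)
Lemma gamma_half_converges :
  exists L : R, L <> 0 /\ is_lim_seq (gamma_seq (- (1 / 2))) L.
Proof.
assert (Pi : forall n, 0 < INR (S n)) by (intros; apply lt_0_INR; lia).
assert (G0 : forall n, 0 < gamma_square (S n)).
{ intros n; pose proof (half_prod_neg (S n)); pose proof (INR_fact_lt_0 (S n)).
  unfold gamma_square; apply Rdiv_lt_0_compat; [nra|].
  apply Rmult_lt_0_compat; [apply Pi|nra]. }
assert (D : ex_finite_lim_seq (fun n => gamma_square (S n))).
{ apply ex_finite_lim_seq_decr with 0; [|intros; apply Rlt_le, G0].
  intros n; rewrite gamma_square_step; pose proof (Pi n); pose proof (G0 n).
  rewrite <- (Rmult_1_r (gamma_square (S n))) at 2.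
  apply Rmult_le_compat_l; [lra|]; apply Rle_div_l; nra. }
destruct D as [l Hl].
assert (B : forall n, gamma_square 1 / 2 <= gamma_square (S n)).
{ assert (I : forall n, gamma_square 1 / 2
                        <= gamma_square (S n) * (INR (S n) / (INR (S n) + 1))).
  { induction n as [|n IH]; [simpl; lra|].
    eapply Rle_trans; [exact IH|]; rewrite gamma_square_step, (S_INR (S n)).
    pose proof (Pi n) as P; pose proof (G0 n) as Q.
    set (i := INR (S n)) in *; set (s := gamma_square (S n)) in *; clearbody i s.
    rewrite Rmult_assoc; apply Rmult_le_compat_l; [lra|].
    refine (proj2 (Rle_div_l _ _ _ _) _); [lra|].
    replace (i * (i + 1) / (i + 1 / 2) ^ 2 * ((i + 1) / (i + 1 + 1)) * (i + 1))
      with (i * (i + 1) ^ 3 / ((i + 1 / 2) ^ 2 * (i + 2))) by (field; lra).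
    assert (0 < (i + 1 / 2) ^ 2 * (i + 2)) by (apply Rmult_lt_0_compat; nra).
    refine (proj1 (Rle_div_r _ _ _ _) _); [lra|].
    assert (0 <= i * i) by nra; nra. }
  intros n; eapply Rle_trans; [apply I|].
  pose proof (Pi n); pose proof (G0 n).
  assert (Q : INR (S n) / (INR (S n) + 1) <= 1) by (refine (proj2 (Rle_div_l _ _ _ _) _); lra).
  rewrite <- (Rmult_1_r (gamma_square (S n))) at 2; apply Rmult_le_compat_l; lra. }
assert (Pl : 0 < l).
{ pose proof (is_lim_seq_le _ _ _ _ B (is_lim_seq_const _) Hl) as T; simpl in T.
  pose proof (G0 O); lra. }
exists (- sqrt l); split; [pose proof (sqrt_lt_R0 _ Pl); lra|].
apply is_lim_seq_incr_1.
apply is_lim_seq_ext with (fun n => - sqrt (gamma_square (S n)));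
  [intros; symmetry; apply gamma_seq_half|].
apply (is_lim_seq_opp _ (sqrt l)).
apply is_lim_seq_continuous; [apply continuity_pt_sqrt; lra|exact Hl].
Qed.

(** Iterating the functional equation gives Gamma(-1/2 + j) = L a_j j!, so every term of the series
    is L times [mean_coef b j]. *)
Lemma beta_equation_iff (b : R) :
  0 < b -> (beta_equation b <-> Series (mean_coef b) = 1 / 3).
Proof.
intros Hb; destruct gamma_half_converges as [L [NL HL]].
assert (G : forall j, Gamma (- (1 / 2) + INR j) = L * (sqrt_coef j * INR (fact j))).
{ intros j; unfold Gamma.
  assert (K : is_lim_seq (gamma_seq (- (1 / 2) + INR j)) (L * (sqrt_coef j * INR (fact j)))).
  { induction j as [|j IH].
    - simpl; rewrite Rplus_0_r, !Rmult_1_r; exact HL.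
    - apply gamma_seq_shift in IH.
      + replace (- (1 / 2) + INR (S j)) with (- (1 / 2) + INR j + 1) by (rewrite S_INR; ring).
        replace (L * (sqrt_coef (S j) * INR (fact (S j))))
          with ((- (1 / 2) + INR j) * (L * (sqrt_coef j * INR (fact j)))); [exact IH|].
        rewrite fact_simpl, mult_INR.
        replace (L * (sqrt_coef (S j) * (INR (S j) * INR (fact j))))
          with (L * (INR (S j) * sqrt_coef (S j)) * INR (fact j)) by ring.
        rewrite sqrt_coef_S; ring.
      + intros k; rewrite Rplus_assoc, <- plus_INR; apply half_pole_free. }
  apply is_lim_seq_unique in K; unfold gamma_seq in K; rewrite K; reflexivity. }
assert (T : forall j, beta_term b j = L * mean_coef b j).
{ intros j; unfold beta_term, mean_coef; rewrite G.
  pose proof (INR_fact_lt_0 j); pose proof (mean_coef_denominator b j Hb); field; lra. }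
assert (G0 : Gamma (- (1 / 2)) = L).
{ pose proof (G O) as E; simpl in E; rewrite Rplus_0_r in E; rewrite E; ring. }
unfold beta_equation; rewrite G0, (Series_ext _ _ T), Series_scal_l.
assert (E : 3 / L * (L * Series (mean_coef b)) - 1 = 3 * Series (mean_coef b) - 1)
  by (field; exact NL).
rewrite E; split; [lra|]; intros H; split; [|lra].
eapply ex_series_ext; [intros n; symmetry; apply T|].
apply (@ex_series_scal R_AbsRing R_NormedModule), unit_drop_is_series, mean_coef_unit_drop, Hb.
Qed.

(** * The inverse of the nephroid map *)

(** From x^3 - y^3 = (x^2 + x y + y^2)(x - y): on a disc of radius m < 1 the map w^3 / 3 contracts
    by m^2. *)
Lemma Cmod_cube_diff (x y : C) (m : R) :
  Cmod x <= m -> Cmod y <= m ->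
  Cmod ((x ^ 3 - y ^ 3) / RtoC 3)%C <= m ^ 2 * Cmod (x - y)%C.
Proof.
intros Hx Hy; pose proof (Cmod_ge_0 x); pose proof (Cmod_ge_0 y).
replace ((x ^ 3 - y ^ 3) / RtoC 3)%C
  with ((x * x + x * y + y * y) / RtoC 3 * (x - y))%C
  by (field; apply RtoC_neq; lra).
rewrite Cmod_mult; apply Rmult_le_compat_r; [apply Cmod_ge_0|].
rewrite Cmod_div, Cmod_R, Rabs_pos_eq by (lra || (apply RtoC_neq; lra)).
assert (Cmod (x * x + x * y + y * y)%C <= m * m + m * m + m * m).
{ eapply Rle_trans; [apply Cmod_triangle|]; apply Rplus_le_compat;
    [eapply Rle_trans; [apply Cmod_triangle|]; apply Rplus_le_compat|];
    rewrite Cmod_mult; apply Rmult_le_compat; assumption. }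
lra.
Qed.

(* Fixed point iteration for [w = zeta + w^3 / 3]; the disc of radius
   [|zeta| + 1/3 < 1] is mapped into itself. *)
Fixpoint nephroid_iter (zeta : C) (n : nat) : C :=
  match n with
  | O => RtoC 0
  | S n => (zeta + nephroid_iter zeta n ^ 3 / RtoC 3)%C
  end.

(** The limit of the iteration, written as a telescoping series so that [Csum_correct] provides its
    existence. *)
Definition nephroid_inv (zeta : C) : C :=
  Csum (fun n => nephroid_iter zeta (S n) - nephroid_iter zeta n)%C.

Lemma nephroid_iter_bound (zeta : C) (n : nat) :
  Cmod zeta < 2 / 3 -> Cmod (nephroid_iter zeta n) <= Cmod zeta + 1 / 3.
Proof.
intros Hz; pose proof (Cmod_ge_0 zeta); induction n as [|n IH].
- simpl; rewrite Cmod_0; lra.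
- change (nephroid_iter zeta (S n)) with (zeta + nephroid_iter zeta n ^ 3 / RtoC 3)%C.
  eapply Rle_trans; [apply Cmod_triangle|].
  rewrite Cmod_div, Cmod_R, Rabs_pos_eq, Cmod_pow by (lra || (apply RtoC_neq; lra)).
  pose proof (Cmod_ge_0 (nephroid_iter zeta n)).
  pose proof (pow_le_1 (Cmod (nephroid_iter zeta n)) 3 ltac:(lra)); lra.
Qed.

Lemma nephroid_iter_step (zeta : C) (n : nat) :
  Cmod zeta < 2 / 3 ->
  Cmod (nephroid_iter zeta (S n) - nephroid_iter zeta n)%C
  <= ((Cmod zeta + 1 / 3) ^ 2) ^ n.
Proof.
intros Hz; pose proof (Cmod_ge_0 zeta) as P; induction n as [|n IH].
- rewrite pow_O; change (Cmod (zeta + RtoC 0 ^ 3 / RtoC 3 - RtoC 0)%C <= 1).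
  replace (zeta + RtoC 0 ^ 3 / RtoC 3 - RtoC 0)%C with zeta
    by (field; apply RtoC_neq; lra); lra.
- replace (nephroid_iter zeta (S (S n)) - nephroid_iter zeta (S n))%C
    with ((nephroid_iter zeta (S n) ^ 3 - nephroid_iter zeta n ^ 3) / RtoC 3)%C.
  2:{ change (nephroid_iter zeta (S (S n)))
        with (zeta + nephroid_iter zeta (S n) ^ 3 / RtoC 3)%C.
      change (nephroid_iter zeta (S n)) with (zeta + nephroid_iter zeta n ^ 3 / RtoC 3)%C at 3.
      field; apply RtoC_neq; lra. }
  eapply Rle_trans; [apply (Cmod_cube_diff _ _ (Cmod zeta + 1 / 3));
    apply nephroid_iter_bound, Hz|].
  change (((Cmod zeta + 1 / 3) ^ 2) ^ S n)
    with ((Cmod zeta + 1 / 3) ^ 2 * ((Cmod zeta + 1 / 3) ^ 2) ^ n).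
  apply Rmult_le_compat_l; [apply pow_le; lra|exact IH].
Qed.

Lemma nephroid_inv_lim (zeta : C) :
  Cmod zeta < 2 / 3 -> forall eps, 0 < eps ->
  exists N, forall n, (N <= n)%nat ->
    Cmod (nephroid_iter zeta (S n) - nephroid_inv zeta)%C < eps.
Proof.
intros Hz; pose proof (Cmod_ge_0 zeta).
assert (E : forall n, Cpartial (fun n => nephroid_iter zeta (S n) - nephroid_iter zeta n)%C n
            = nephroid_iter zeta (S n)).
{ induction n as [|n IH]; [simpl; ring|].
  change (Cpartial (fun n => nephroid_iter zeta (S n) - nephroid_iter zeta n)%C n
    + (nephroid_iter zeta (S (S n)) - nephroid_iter zeta (S n))
    = nephroid_iter zeta (S (S n)))%C.
  rewrite IH; ring. }
intros eps Heps.
destruct (Csum_correct (fun n => nephroid_iter zeta (S n) - nephroid_iter zeta n)%C)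
  with (eps := eps) as [N HN]; [|exact Heps|].
- apply (@ex_series_le R_AbsRing R_CompleteNormedModule)
    with (fun n => ((Cmod zeta + 1 / 3) ^ 2) ^ n).
  + intros n; eapply Rle_trans; [|apply nephroid_iter_step, Hz].
    right; apply Rabs_pos_eq, Cmod_ge_0.
  + apply ex_series_geom; rewrite Rabs_pos_eq by nra; nra.
- exists N; intros n Hn; specialize (HN n Hn); rewrite E in HN; exact HN.
Qed.

Lemma nephroid_inv_bound (zeta : C) :
  Cmod zeta < 2 / 3 -> Cmod (nephroid_inv zeta) <= Cmod zeta + 1 / 3.
Proof.
intros Hz; apply le_epsilon; intros eps Heps.
destruct (nephroid_inv_lim zeta Hz eps Heps) as [N HN]; specialize (HN N (le_n N)).
pose proof (nephroid_iter_bound zeta (S N) Hz).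
replace (nephroid_inv zeta)
  with (nephroid_iter zeta (S N) - (nephroid_iter zeta (S N) - nephroid_inv zeta))%C by ring.
eapply Rle_trans; [apply Cmod_minus_le|]; lra.
Qed.

(** Limit in the fixed point equation: two consecutive iterates are close to w, and w^3 / 3 is
    1-Lipschitz on the unit disc. *)
Lemma nephroid_inv_spec (zeta : C) :
  Cmod zeta < 2 / 3 ->
  (nephroid_inv zeta - nephroid_inv zeta ^ 3 / RtoC 3)%C = zeta.
Proof.
intros Hz; pose proof (Cmod_ge_0 zeta); set (w := nephroid_inv zeta).
assert (E : (w - w ^ 3 / RtoC 3 - zeta)%C = 0).
{ apply Cmod_eq_0, Rle_antisym; [|apply Cmod_ge_0].
  apply le_epsilon; intros eps Heps.
  destruct (nephroid_inv_lim zeta Hz (eps / 2)) as [N HN]; [lra|]; fold w in HN.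
  pose proof (HN N (le_n N)) as H1; pose proof (HN (S N) (le_S _ _ (le_n N))) as H2.
  change (nephroid_iter zeta (S (S N)))
    with (zeta + nephroid_iter zeta (S N) ^ 3 / RtoC 3)%C in H2.
  pose proof (nephroid_iter_bound zeta (S N) Hz) as B1.
  pose proof (nephroid_inv_bound zeta Hz) as B2; fold w in B2.
  set (x := nephroid_iter zeta (S N)) in *.
  pose proof (Cmod_cube_diff x w (Cmod zeta + 1 / 3) B1 B2) as B3.
  replace (w - w ^ 3 / RtoC 3 - zeta)%C
    with ((x ^ 3 - w ^ 3) / RtoC 3 - (zeta + x ^ 3 / RtoC 3 - w))%C
    by (field; apply RtoC_neq; lra).
  eapply Rle_trans; [apply Cmod_minus_le|].
  pose proof (Cmod_ge_0 (x - w)%C).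
  assert ((Cmod zeta + 1 / 3) ^ 2 <= 1) by (apply pow_le_1; lra).
  nra. }
replace (w - w ^ 3 / RtoC 3)%C with ((w - w ^ 3 / RtoC 3 - zeta) + zeta)%C by ring.
rewrite E; ring.
Qed.

(** The bound places w in the disc of radius 1/3, where w = w^3 / 3 forces |w| <= |w| / 9. *)
Lemma nephroid_inv_0 : nephroid_inv (RtoC 0) = RtoC 0.
Proof.
assert (H0 : Cmod (RtoC 0) < 2 / 3) by (rewrite Cmod_0; lra).
set (w := nephroid_inv (RtoC 0)).
pose proof (nephroid_inv_spec _ H0) as E; pose proof (nephroid_inv_bound _ H0) as B.
fold w in E, B; rewrite Cmod_0 in B.
pose proof (Cmod_cube_diff w 0 (0 + 1 / 3) B ltac:(rewrite Cmod_0; lra)) as D.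
replace ((w ^ 3 - RtoC 0 ^ 3) / RtoC 3)%C with (w - (w - w ^ 3 / RtoC 3))%C in D
  by (field; apply RtoC_neq; lra).
rewrite E in D; replace (w - 0)%C with w in D by ring.
apply Cmod_eq_0; pose proof (Cmod_ge_0 w); nra.
Qed.

Lemma nephroid_inv_has_cderiv (zeta : C) :
  Cmod zeta < 2 / 3 -> exists l, has_cderiv nephroid_inv zeta l.
Proof.
intros Hz; pose proof (Cmod_ge_0 zeta).
set (w := nephroid_inv zeta); exists (/ (1 - w * w))%C.
(* Half the distance to the circle of radius 2/3, so that the inverses of zeta and zeta + h share a
   bound M < 1. *)
set (d := (2 / 3 - Cmod zeta) / 2).
set (M := Cmod zeta + d + 1 / 3).
assert (HM : 0 <= M < 1) by (unfold M, d; lra).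
assert (HM2 : 0 < 1 - M ^ 2) by nra.
apply has_cderiv_square with (2 / (1 - M ^ 2) ^ 3) d; [unfold d; lra|].
intros h Hh; fold w.
assert (Hzh : Cmod (zeta + h)%C <= Cmod zeta + d)
  by (eapply Rle_trans; [apply Cmod_triangle|lra]).
assert (Hzh' : Cmod (zeta + h)%C < 2 / 3) by (unfold d in *; lra).
set (v := nephroid_inv (zeta + h)%C).
assert (Bw : Cmod w <= M).
{ eapply Rle_trans; [apply nephroid_inv_bound, Hz|unfold M, d; lra]. }
assert (Bv : Cmod v <= M).
{ eapply Rle_trans; [apply nephroid_inv_bound, Hzh'|unfold M; lra]. }
pose proof (nephroid_inv_spec _ Hz) as Ew; fold w in Ew.
pose proof (nephroid_inv_spec _ Hzh') as Ev; fold v in Ev.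
assert (N3 : RtoC 3 <> 0) by (apply RtoC_neq; lra).
set (D := (v - w)%C).
assert (Eh : (h = D - (v ^ 3 - w ^ 3) / RtoC 3)%C).
{ replace h with ((zeta + h) - zeta)%C by ring; rewrite <- Ev, <- Ew at 1.
  unfold D; field; exact N3. }
assert (L : (1 - M ^ 2) * Cmod D <= Cmod h).
{ pose proof (Cmod_cube_diff v w M Bv Bw) as Q; fold D in Q.
  pose proof (Cmod_rev_triangle D (- ((v ^ 3 - w ^ 3) / RtoC 3))%C) as T.
  rewrite Cmod_opp in T; rewrite Eh; unfold Cminus at 1; lra. }
assert (G : 1 - M ^ 2 <= Cmod (1 - w * w)%C).
{ pose proof (Cmod_rev_triangle 1 (- (w * w))%C) as T.
  rewrite Cmod_opp, Cmod_mult, Cmod_1 in T; unfold Cminus.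
  pose proof (Cmod_ge_0 w); nra. }
assert (N1 : (1 - w * w)%C <> 0) by (apply Cmod_gt_0; lra).
(* Expanding v = w + D gives h = (1 - w^2) D - D^2 (w + D / 3). The error is thus quadratic in D,
   and [L] bounds |D| by |h| / (1 - M^2). *)
replace (D - / (1 - w * w) * h)%C
  with (D * D * (w + D / RtoC 3) / (1 - w * w))%C.
2:{ rewrite Eh; unfold D; field; repeat split; assumption. }
rewrite Cmod_div, !Cmod_mult by exact N1.
assert (B2 : Cmod (w + D / RtoC 3)%C <= 2).
{ eapply Rle_trans; [apply Cmod_triangle|].
  rewrite Cmod_div, Cmod_R, Rabs_pos_eq by (lra || exact N3).
  assert (Cmod D <= 2) by (eapply Rle_trans; [apply Cmod_minus_le|lra]); lra. }
pose proof (Cmod_ge_0 D) as PD.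
refine (proj2 (Rle_div_l _ _ _ _) _); [lra|].
apply Rle_trans with (2 * Cmod D ^ 2); [nra|].
assert (L2 : ((1 - M ^ 2) * Cmod D) ^ 2 <= Cmod h ^ 2) by (apply pow_incr; nra).
apply Rle_trans with (2 / (1 - M ^ 2) ^ 3 * Cmod h ^ 2 * (1 - M ^ 2)).
- replace (2 / (1 - M ^ 2) ^ 3 * Cmod h ^ 2 * (1 - M ^ 2))
    with (2 * (Cmod h ^ 2 / (1 - M ^ 2) ^ 2)) by (field; lra).
  apply Rmult_le_compat_l; [lra|].
  refine (proj1 (Rle_div_r _ _ _ _) _); nra.
- apply Rmult_le_compat_l; [|exact G].
  apply Rmult_le_pos; [apply Rlt_le, Rdiv_lt_0_compat; [lra|apply pow_lt; lra]|nra].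
Qed.

(** * The differential subordination *)

(* At a positive maximum of [D] on [0, r] the derivative would be negative. *)
Lemma differential_comparison (D D' : R -> R) (beta r : R) :
  0 < beta -> 0 <= r ->
  (forall t, 0 <= t <= r -> is_derive D t (D' t)) ->
  D 0 <= 0 ->
  (forall t, 0 < t <= r -> D t + beta * t * D' t <= 0) ->
  D r <= 0.
Proof.
intros Hb Hr HD H0 H; apply Rnot_lt_le; intros P.
destruct (continuity_ab_maj D 0 r Hr) as [m [Hmax Hm]].
{ intros t Ht; apply continuity_pt_filterlim, (ex_derive_continuous D).
  exists (D' t); apply HD, Ht. }
pose proof (Hmax r ltac:(lra)) as Pm.
(* The maximum is positive while D 0 <= 0, so it is not attained at 0 and a step to the left stays
   in the interval. *)
assert (Hm0 : 0 < m) by (destruct (Req_dec m 0) as [->|]; lra).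
specialize (H m ltac:(lra)).
assert (Hn : D' m < 0).
{ apply Rnot_le_lt; intros N; assert (0 <= beta * m * D' m) by (apply Rmult_le_pos; nra); lra. }
destruct (proj1 (is_derive_Reals _ _ _) (HD m Hm) (- D' m) ltac:(lra)) as [d Hd].
pose proof (cond_pos d) as Pd; set (h := Rmin (d / 2) m).
assert (Ph : 0 < h) by (apply Rmin_glb_lt; lra).
pose proof (Rmin_l (d / 2) m) as h1; pose proof (Rmin_r (d / 2) m) as h2; fold h in h1, h2.
specialize (Hd (- h) ltac:(lra) ltac:(rewrite Rabs_Ropp, Rabs_pos_eq; lra)).
apply Rabs_def2 in Hd; destruct Hd as [Hd _].
specialize (Hmax (m + - h) ltac:(lra)).
assert (0 <= (D (m + - h) - D m) / - h).
{ replace ((D (m + - h) - D m) / - h) with ((D m - D (m + - h)) / h) by (field; lra).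
  apply Rdiv_le_0_compat; lra. }
lra.
Qed.

Lemma analytic_has_cderiv (f : C -> C) (z : C) :
  analytic_on_disc f -> in_disc z -> has_cderiv f z (C_derive f z).
Proof.
intros Hf Hz; apply is_derive_has_cderiv, C_derive_correct; [exact z|apply Hf, Hz].
Qed.

(** With z fixed and c the conjugate of p z - 1, put D(t) = Re (c (p(t z) - 1)) - |c| (1 - B(t
    rho)). Then D + beta t D' is the same expression with p replaced by p + beta z p' and B by A,
    and is nonpositive by the Schwarz lemma. At t = 1 this reads |p z - 1|^2 <= |p z - 1| (1 -
    B(rho)). *)
Lemma subordinate_bound (p : C -> C) (beta : R) (z : C) :
  0 < beta -> analytic_on_disc p -> p (RtoC 0) = RtoC 1 ->
  subordinate (fun z => p z + RtoC beta * z * C_derive p z)%C phi_L ->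
  in_disc z ->
  Cmod (p z - 1)%C <= 1 - Series (fun n => mean_coef beta n * Cmod z ^ n).
Proof.
intros Hb Hp P0 (w & Hw & W0 & W1 & E) Hz; set (rho := Cmod z).
assert (Hrho : 0 <= rho < 1) by (split; [apply Cmod_ge_0|exact Hz]).
assert (Hr : in_disc (RtoC rho))
  by (unfold in_disc; rewrite Cmod_R, Rabs_pos_eq; lra).
pose proof (mean_coef_unit_drop beta Hb) as HK.
pose proof (unit_drop_bounded _ HK) as BK.
set (B := cpower_series (mean_coef beta)).
set (B' := cpower_series (deriv_coef (mean_coef beta))).
set (c := Cconj (p z - 1)%C).
set (D := fun t : R => Re (c * p (RtoC t * z))%C
            + Re (RtoC (Cmod c) * B (RtoC t * RtoC rho))%C - (Re c + Cmod c)).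
assert (HD : D 1 <= 0).
{ apply (differential_comparison D
    (fun t => Re (c * (C_derive p (RtoC t * z) * z))%C
            + Re (RtoC (Cmod c) * (B' (RtoC t * RtoC rho) * RtoC rho))%C - 0) beta);
    [exact Hb|lra| | |].
  - intros t Ht; apply (is_derive_minus (V := R_NormedModule)); [|apply is_derive_Reals, derivable_pt_lim_const].
    apply (is_derive_plus (V := R_NormedModule)).
    + apply has_cderiv_ray, analytic_has_cderiv, in_disc_ray; assumption.
    + apply has_cderiv_ray, cpower_series_has_cderiv;
        [exact BK|apply mean_coef_deriv_bounded, Hb|apply in_disc_ray; assumption].
  - unfold D; rewrite !Cmult_0_l, P0; unfold B; rewrite cpower_series_0 by exact BK.
    replace (mean_coef beta 0) with 1 by (symmetry; apply HK).
    rewrite !Cmult_1_r; simpl; lra.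
  - intros t Ht.
    pose proof (in_disc_ray t z ltac:(lra) Hz) as Htz.
    pose proof (in_disc_ray t (RtoC rho) ltac:(lra) Hr) as Htr.
    specialize (E _ Htz); cbv beta in E.
    pose proof (mean_coef_ode beta (RtoC t * RtoC rho)%C Hb Htr) as O; fold B B' in O.
    rewrite <- RtoC_mult in O at 4; rewrite cpower_series_real in O.
    assert (Sw : Cmod (w (RtoC t * z)%C) <= t * rho).
    { replace (t * rho) with (Cmod (RtoC t * z)%C)
        by (rewrite Cmod_mult, Cmod_R, Rabs_pos_eq by lra; reflexivity).
      apply schwarz; try assumption.
      intros x Hx; eexists; apply analytic_has_cderiv; eassumption. }
    set (ww := w (RtoC t * z)%C) in *.
    assert (Dw : in_disc (- ww)%C) by (unfold in_disc; rewrite Cmod_opp; nra).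
    pose proof (phi_L_series _ Dw) as F.
    replace (- - ww)%C with ww in F by ring; rewrite F in E.
    pose proof (unit_drop_cpower_series sqrt_coef (- ww)%C (t * rho) sqrt_coef_unit_drop
      ltac:(rewrite Cmod_opp; exact Sw) ltac:(nra)) as U.
    rewrite <- E in U.
    set (s := Series (fun n => sqrt_coef n * (t * rho) ^ n)) in *.
    set (q := (p (RtoC t * z) + RtoC beta * (RtoC t * z) * C_derive p (RtoC t * z))%C) in *.
    replace (D t + beta * t * _)
      with (Re (c * (q - 1))%C + Cmod c * Re (B (RtoC t * RtoC rho)
        + RtoC beta * (RtoC t * RtoC rho) * B' (RtoC t * RtoC rho))%C - Cmod c).
    2:{ unfold D, q; generalize (p (RtoC t * z)%C) (C_derive p (RtoC t * z)%C)
          (B (RtoC t * RtoC rho)%C) (B' (RtoC t * RtoC rho)%C) (Cmod c).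
        intros x1 x2 x3 x4 k; destruct c, z, x1, x2, x3, x4; simpl; ring. }
    rewrite O; simpl (Re (RtoC s)).
    pose proof (re_le_Cmod (c * (q - 1))%C) as R1; rewrite Cmod_mult in R1.
    apply Rabs_le_between in R1; pose proof (Cmod_ge_0 c); nra. }
unfold D in HD; rewrite !Cmult_1_l in HD; unfold B in HD; rewrite cpower_series_real in HD.
set (s := Series _) in *.
assert (Ec : Re (c * p z)%C - Re c = Cmod (p z - 1)%C ^ 2).
{ rewrite Cmod2_alt; unfold c; destruct (p z); simpl; ring. }
assert (Em : Cmod c = Cmod (p z - 1)%C) by apply Cmod_conj.
assert (Ek : Re (RtoC (Cmod c) * RtoC s)%C = Cmod c * s) by (simpl; ring).
rewrite Ek, Em in HD.
pose proof (Cmod_ge_0 (p z - 1)%C) as Pc.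
(* If |p z - 1| exceeded 1 - s >= 0 it would be positive and could be cancelled in [HD]. *)
assert (S1 : s <= 1).
{ pose proof (unit_drop_Series_le _ 0 (unit_drop_scaled _ rho HK ltac:(lra))) as T.
  fold s in T; simpl in T; replace (mean_coef beta 0) with 1 in T by (symmetry; apply HK); lra. }
apply Rnot_lt_le; intros Q; nra.
Qed.

(** The subordinating function is the inverse applied to p - 1; its modulus is at most |p - 1| + 1/3
    < 1. *)
Lemma phi_Ne_disc_subordinate (p : C -> C) :
  analytic_on_disc p -> p (RtoC 0) = RtoC 1 ->
  (forall z, in_disc z -> Cmod (p z - 1)%C < 2 / 3) -> subordinate p phi_Ne.
Proof.
intros Hp P0 H; exists (fun z => nephroid_inv (p z - 1)%C); repeat split.
- intros z Hz; destruct (nephroid_inv_has_cderiv _ (H z Hz)) as [l Hl].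
  eexists; apply has_cderiv_is_derive.
  apply (has_cderiv_comp nephroid_inv (fun z => p z - 1)%C); [exact Hl|].
  apply (has_cderiv_plus p (fun _ => - (1))%C);
    [apply analytic_has_cderiv; assumption|apply has_cderiv_const].
- rewrite P0; replace (1 - 1)%C with (RtoC 0) by ring; apply nephroid_inv_0.
- intros z Hz; specialize (H z Hz).
  eapply Rle_lt_trans; [apply nephroid_inv_bound, H|lra].
- intros z Hz; specialize (H z Hz).
  unfold phi_Ne; pose proof (nephroid_inv_spec _ H) as E.
  set (v := nephroid_inv (p z - 1)%C) in *.
  replace (RtoC 1 + v - v ^ 3 / RtoC 3)%C with (RtoC 1 + (v - v ^ 3 / RtoC 3))%C by ring.
  rewrite E; ring.
Qed.

(** * Sharpness of the bound on beta *)

Lemma bernoulli (e : R) (n : nat) : 0 <= e <= 1 -> 1 - INR n * e <= (1 - e) ^ n.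
Proof.
intros He; induction n as [|n IH]; [simpl; lra|].
pose proof (pow_le_1 (1 - e) n ltac:(lra)).
change ((1 - e) ^ S n) with ((1 - e) * (1 - e) ^ n); rewrite S_INR; nra.
Qed.

(** The imaginary part is v (1 - u^2 + v^2 / 3) with a positive second factor, so v = 0; then x -
    1/3 = (u + 1)^2 (2 - u) / 3. *)
Lemma phi_Ne_real_gt (w : C) (x : R) : in_disc w -> phi_Ne w = RtoC x -> 1 / 3 < x.
Proof.
unfold in_disc; intros Hw E; destruct w as [u v].
pose proof (Cmod2_alt (u, v)) as M; simpl in M; pose proof (Cmod_ge_0 (u, v)).
assert (Huv : u * u + v * v < 1) by nra.
assert (E3 : phi_Ne (u, v)
  = (1 + u - (u * u * u - 3 * u * v * v) / 3, v - (3 * u * u * v - v * v * v) / 3)).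
{ unfold phi_Ne; replace (/ RtoC 3)%C with (RtoC (/ 3)) by (apply RtoC_inv; lra).
  unfold Cdiv; rewrite <- RtoC_inv by lra.
  apply injective_projections; simpl; field. }
rewrite E3 in E; injection E as E1 E2.
assert (Hv : v = 0).
{ assert (F : v * (1 - u * u + v * v / 3) = 0) by lra.
  apply Rmult_integral in F; destruct F as [F|F]; [exact F|nra]. }
subst v; rewrite <- E1.
assert (-1 < u < 1) by nra.
assert (0 < (u + 1) * (u + 1) * (2 - u)) by (apply Rmult_lt_0_compat; nra).
lra.
Qed.

(* The extremal function is [q(z) = B(-z)], where [B] has coefficients
   [mean_coef b]: its values at [-r] are real and tend to [Series (mean_coef b)]. *)
Lemma implication_fails (b : R) :
  0 < b -> Series (mean_coef b) < 1 / 3 -> ~ implication_at b.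
Proof.
intros Hb HS Himp.
pose proof (mean_coef_unit_drop b Hb) as HK; pose proof (unit_drop_bounded _ HK) as BK.
set (q := fun z => cpower_series (mean_coef b) (- (1) * z)%C).
assert (Hneg : forall z, in_disc z -> in_disc (- (1) * z)%C).
{ intros z Hz; unfold in_disc; rewrite Cmod_mult, Cmod_opp, Cmod_1, Rmult_1_l; exact Hz. }
assert (Dq : forall z, in_disc z -> has_cderiv q z
  (cpower_series (deriv_coef (mean_coef b)) (- (1) * z) * (- (1) * 1))%C).
{ intros z Hz; apply (has_cderiv_comp _ (fun z => - (1) * z)%C).
  - apply cpower_series_has_cderiv; [exact BK|apply mean_coef_deriv_bounded, Hb|apply Hneg, Hz].
  - apply has_cderiv_scal, has_cderiv_id. }
destruct (Himp q) as (w & _ & _ & W1 & Ew).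
- intros z Hz; eexists; apply has_cderiv_is_derive, Dq, Hz.
- unfold q; rewrite Cmult_0_r, cpower_series_0 by exact BK; f_equal; apply HK.
(* The identity works, since q + b z q' is exactly A(-z) = phi_L(z). *)
- exists (fun z => z); repeat split; try tauto.
  + intros z _; eexists; apply has_cderiv_is_derive, has_cderiv_id.
  + intros z Hz.
    rewrite (is_C_derive_unique _ _ _ (has_cderiv_is_derive _ _ _ (Dq z Hz))).
    pose proof (phi_L_series _ (Hneg z Hz)) as F.
    replace (- (- (1) * z))%C with z in F by ring.
    rewrite F, <- (mean_coef_ode b) by auto.
    unfold q; ring.
- destruct (proj1 (is_lim_seq_Reals _ _) (mean_coef_lim b Hb) (1 / 3 - Series (mean_coef b)))
    as [N HN]; [lra|].
  specialize (HN N (le_n N)); unfold Rdist in HN; apply Rabs_def2 in HN.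
  (* Some partial sum at 1 already lies below 1/3. Moving from 1 to r = 1 - e costs at most (N + 1)
     e <= g / 2, and the full series at r lies below its partial sum. *)
  set (g := 1 / 3 - sum_f_R0 (mean_coef b) N).
  assert (Hg : 0 < g) by (unfold g; lra).
  set (e := Rmin (1 / 2) (g / (2 * (INR N + 1)))).
  pose proof (pos_INR N) as PN.
  assert (He : 0 < e <= 1 / 2).
  { split; [apply Rmin_glb_lt; [lra|apply Rdiv_lt_0_compat; lra]|apply Rmin_l]. }
  assert (He2 : (INR N + 1) * e <= g / 2).
  { apply Rle_trans with ((INR N + 1) * (g / (2 * (INR N + 1)))).
    - apply Rmult_le_compat_l; [lra|apply Rmin_r].
    - right; field; lra. }
  set (r := 1 - e).
  (* Each term grows by at most e: 1 - r^n <= n e by Bernoulli, and n times the n-th coefficient is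
     at most 1 in modulus. *)
  assert (I : forall n, sum_f_R0 (fun k => mean_coef b k * r ^ k) n
                        <= sum_f_R0 (mean_coef b) n + (INR n + 1) * e).
  { induction n as [|n IH]; [simpl; lra|].
    rewrite !tech5, S_INR.
    assert (P : 1 - INR (S n) * e <= r ^ S n).
    { apply bernoulli; lra. }
    pose proof (mean_coef_deriv_bounded b Hb n) as Q; unfold deriv_coef in Q.
    apply Rabs_le_between in Q; pose proof (proj1 (proj2 HK) n); nra. }
  pose proof (unit_drop_Series_le _ N (unit_drop_scaled _ r HK ltac:(unfold r; lra))) as T.
  assert (Hr : in_disc (RtoC (- r))).
  { unfold in_disc; rewrite Cmod_R, Rabs_Ropp, Rabs_pos_eq; unfold r; lra. }
  specialize (Ew _ Hr); specialize (W1 _ Hr); specialize (I N).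
  unfold q in Ew.
  replace (- (1) * RtoC (- r))%C with (RtoC r) in Ew by (rewrite RtoC_opp; ring).
  rewrite cpower_series_real in Ew.
  pose proof (phi_Ne_real_gt _ _ W1 (eq_sym Ew)); unfold g in *; lra.
Qed.

Theorem theorem5p1 :
  exists betaL : R,
    (0 < betaL /\ beta_equation betaL /\
     (forall b : R, 0 < b -> beta_equation b -> b = betaL)) /\
    (forall beta : R, betaL <= beta -> implication_at beta) /\
    (forall b : R, 0 < b < betaL ->
       ~ (forall beta : R, b <= beta -> implication_at beta)).
Proof.
destruct mean_coef_root as [bL [PL EL]].
exists bL; split; [split; [exact PL|split]|split].
- apply beta_equation_iff; assumption.
- intros b Pb Eb; apply beta_equation_iff in Eb; [|exact Pb].
  destruct (Rtotal_order b bL) as [L|[E|L]]; [|exact E|].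
  + pose proof (mean_coef_Series_increasing b bL ltac:(lra)); lra.
  + pose proof (mean_coef_Series_increasing bL b ltac:(lra)); lra.
- intros beta Hb p Hp P0 Hs; apply phi_Ne_disc_subordinate; [exact Hp|exact P0|].
  intros z Hz; pose proof (Cmod_ge_0 z); unfold in_disc in Hz.
  pose proof (subordinate_bound p beta z ltac:(lra) Hp P0 Hs Hz) as B1.
  (* The factor |z| < 1 gives the strict bound 2/3, including at beta = bL where B(1) is exactly
     1/3. *)
  pose proof (unit_drop_linear_bound (mean_coef beta) (Cmod z)
    (mean_coef_unit_drop beta ltac:(lra)) ltac:(lra)) as B2.
  assert (B3 : 1 / 3 <= Series (mean_coef beta)).
  { destruct (Rle_lt_or_eq_dec _ _ Hb) as [L|<-]; [|lra].
    pose proof (mean_coef_Series_increasing bL beta ltac:(lra)); lra. }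
  nra.
(* The implication already fails at [b] itself. *)
- intros b Hb Himp; apply (implication_fails b); [lra| |apply Himp; lra].
  pose proof (mean_coef_Series_increasing b bL ltac:(lra)); lra.
Qed.
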